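(* Let $\mathfrak{U}$ be a Banach algebra, let $\phi\in\Delta(\mathfrak{U})$, and suppose $\mathfrak{U}$ is $\phi$-Johnson amenable. Let $X$ be a Banach $\mathfrak{U}$-bimodule such that either $x\cdot a=\phi(a)x$ for all $a\in\mathfrak{U}$, $x\in X$, or $a\cdot x=\phi(a)x$ for all $a\in\mathfrak{U}$, $x\in X$. Suppose that $\delta:\mathfrak{U}\to X$ is a continuous Lie derivation. Then there exist a continuous derivation $d:\mathfrak{U}\to X$ and a continuous center-valued trace $\varphi:\mathfrak{U}\to\mathcal{Z}_{\mathfrak{U}}(X)$ such that $\delta=d+\varphi$.
   Context: Banach algebras are complex. $\Delta(\mathfrak{U})$ is the set of all non-zero multiplicative linear functionals on $\mathfrak{U}$. For a Banach $\mathfrak{U}$-bimodule $X$, the dual $X^*$ is a Banach $\mathfrak{U}$-bimodule via $\langle a\cdot f,x\rangle=\langle f,x\cdot a\rangle$ and $\langle f\cdot a,x\rangle=\langle f,a\cdot x\rangle$. The projective tensor product $\mathfrak{U}\widehat{\otimes}\mathfrak{U}$ is a Banach $\mathfrak{U}$-bimodule via $a\cdot(b\otimes c)=ab\otimes c$ and $(b\otimes c)\cdot a=b\otimes ca$; $\pi:\mathfrak{U}\widehat{\otimes}\mathfrak{U}\to\mathfrak{U}$ is the continuous linear map with $\pi(b\otimes c)=bc$. $\mathfrak{U}$ is $\phi$-Johnson amenable if there exists $m\in(\mathfrak{U}\widehat{\otimes}\mathfrak{U})^{**}$ such that $a\cdot m=m\cdot a$ for every $a\in\mathfrak{U}$ and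 $\tilde\phi\circ\pi^{**}(m)=1$, where $\tilde\phi(F)=F(\phi)$ for $F\in\mathfrak{U}^{**}$. The centre of $X$ is $\mathcal{Z}_{\mathfrak{U}}(X)=\{x\in X: a\cdot x=x\cdot a\text{ for all }a\in\mathfrak{U}\}$. A linear map $\delta:\mathfrak{U}\to X$ is a derivation if $\delta(ab)=\delta(a)\cdot b+a\cdot\delta(b)$ for all $a,b\in\mathfrak{U}$, and a Lie derivation if $\delta([a,b])=[\delta(a),b]+[a,\delta(b)]$ for all $a,b\in\mathfrak{U}$, where $[a,b]=ab-ba$, $[a,x]=a\cdot x-x\cdot a$ and $[x,a]=x\cdot a-a\cdot x$ for $a,b\in\mathfrak{U}$, $x\in X$. A center-valued trace is a linear map $\varphi:\mathfrak{U}\to\mathcal{Z}_{\mathfrak{U}}(X)$ with $\varphi([a,b])=0$ for all $a,b\in\mathfrak{U}$. *)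

(* Defs.v *)
From HB Require Import structures.
From mathcomp Require Import all_boot all_order all_algebra.
From mathcomp Require Import mathcomp_extra boolp classical_sets functions reals.
From mathcomp Require Import topology normedtype sequences.
From mathcomp Require Import complex generic_quotient ring_quotient.
From mathcomp Require Import ring lra.

Set Implicit Arguments.
Unset Strict Implicit.
Unset Printing Implicit Defensive.

Import Order.TTheory GRing.Theory Num.Theory.
Import numFieldNormedType.Exports.

Local Open Scope classical_set_scope.
Local Open Scope ring_scope.
Local Open Scope complex_scope.

Local Notation Re := complex.Re.
Local Notation Im := complex.Im.

(* Norms of normed modules over R[i] take values in R[i]; [rnorm] is the same
   norm seen in R. *)
Section rnorm.
Context {R : realType} {X : normedModType R[i]}.
Implicit Types x y : X.

Definition rnorm x : R := Re `|x|.

Lemma rnormE x : `|x| = (rnorm x)%:C.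
Proof. by rewrite RRe_real ?ger0_real. Qed.

Lemma rnorm_ge0 x : 0 <= rnorm x.
Proof. by rewrite -ler0c -rnormE. Qed.

Lemma rnormD x y : rnorm (x + y) <= rnorm x + rnorm y.
Proof. by rewrite -lecR rmorphD/= -!rnormE ler_normD. Qed.

Lemma rnormZ (l : R[i]) x : rnorm (l *: x) = Normc.normc l * rnorm x.
Proof. by apply: complexI; rewrite rmorphM/= -!rnormE normrZ. Qed.

Lemma rnormN x : rnorm (- x) = rnorm x.
Proof. by rewrite /rnorm normrN. Qed.

Lemma rnorm0 : rnorm (0 : X) = 0.
Proof. by rewrite /rnorm normr0. Qed.

Lemma rnorm0_eq0 x : rnorm x = 0 -> x = 0.
Proof. by move=> x0; apply: normr0_eq0; rewrite rnormE x0. Qed.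

Lemma rdistC x y : rnorm (x - y) = rnorm (y - x).
Proof. by rewrite -rnormN opprB. Qed.

Lemma rnorm_ball x y (e : R) : ball x e%:C y <-> rnorm (x - y) < e.
Proof. by rewrite -ball_normE/= rnormE ltcR. Qed.

Definition rcvg (u : nat -> X) (l : X) := forall e : R, 0 < e ->
  exists N, forall n, (N <= n)%N -> rnorm (u n - l) < e.

Definition rcauchy (u : nat -> X) := forall e : R, 0 < e ->
  exists N, forall m n, (N <= m)%N -> (N <= n)%N -> rnorm (u m - u n) < e.

Lemma posC (e : R[i]) : 0 < e -> 0 < Re e /\ e = (Re e)%:C.
Proof.
by case: e => a b; rewrite ltcE/= => /andP[/eqP-> ?].
Qed.

Lemma rcvgP (u : nat -> X) l : rcvg u l <-> u @ \oo --> l.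
Proof.
split => [ul|/cvgrPdist_lt ul e e0].
  apply/cvgrPdist_lt => e /posC[e0 ->]; have [N NP] := ul _ e0.
  exists N => // n /= Nn; rewrite rnormE ltcR rdistC; exact: NP.
have /ul[N _ NP] : 0 < e%:C by rewrite ltcR.
by exists N => n /NP/=; rewrite rnormE ltcR rdistC.
Qed.

Lemma rcvg_lim (u : nat -> X) l : rcvg u l -> lim (u @ \oo) = l.
Proof. by move=> /rcvgP; apply: cvg_lim. Qed.

Lemma rcvg_unique (u : nat -> X) l l' : rcvg u l -> rcvg u l' -> l = l'.
Proof. by move=> /rcvg_lim<- /rcvg_lim. Qed.

Lemma rcomplete : (forall u : nat -> X, rcauchy u -> exists l, rcvg u l) ->
  forall F : set_system X, ProperFilter F -> cauchy F -> cvg F.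
Proof.
move=> H F FF /cauchyP Fc.
have /choice[u uP] (n : nat) : exists x, F (ball x (n.+1%:R^-1 : R)%:C).
  by apply: Fc; rewrite ltcR invr_gt0 ltr0n.
have small (e : R) : 0 < e -> exists N, forall n, (N <= n)%N ->
    (n.+1%:R^-1 : R) < e.
  move=> e0; have /cvgrPdist_lt/(_ _ e0)[N _ NP] := @cvg_harmonic R.
  by exists N => n /NP/=; rewrite sub0r normrN ger0_norm ?invr_ge0.
have ucl : rcauchy u.
  move=> e e0; have /small[N NP] : 0 < e / 2 by rewrite divr_gt0.
  exists N => m n /NP mN /NP nN.
  have [z [/rnorm_ball mz /rnorm_ball nz]] := filter_ex (filterI (uP m) (uP n)).
  have -> : u m - u n = (u m - z) + - (u n - z) by rewrite opprB addrC subrKA addrC.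
  apply: le_lt_trans (rnormD _ _) _; rewrite rnormN [ltRHS]splitr.
  by rewrite ltrD// (lt_trans mz, lt_trans nz).
have [l ul] := H _ ucl; apply/cvg_ex; exists l.
apply/cvg_ballP => e /posC[e0 ->].
have /small[N NP] : 0 < Re e / 2 by rewrite divr_gt0.
have [N' NP'] : exists N, forall n, (N <= n)%N -> rnorm (u n - l) < Re e / 2.
  by apply: ul; rewrite divr_gt0.
have := NP _ (leq_maxl N N'); have := NP' _ (leq_maxr N N').
set k := maxn _ _ => k1 k2; apply: filterS (uP k) => y /rnorm_ball ky.
apply/rnorm_ball; have -> : l - y = - (u k - l) + (u k - y) by rewrite opprB subrKA.
apply: le_lt_trans (rnormD _ _) _; rewrite rnormN [ltRHS]splitr.
by rewrite ltrD// (lt_trans ky).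
Qed.

End rnorm.

Lemma rcauchy_cvg {R : realType} {X : completeNormedModType R[i]}
  (u : nat -> X) : rcauchy u -> exists l, rcvg u l.
Proof.
move=> uc; have /cvg_ex[l ul] : cvg (u @ \oo).
  apply: cauchy_cvg; apply/cauchyP => e /posC[e0 ->].
  have [N NP] := uc _ e0; exists (u N), N => // n /= Nn.
  by apply/rnorm_ball; apply: NP.
by exists l; apply/rcvgP.
Qed.

Section complex_complete.
Variable R : realType.

Lemma complex_rcauchy (u : nat -> R[i]^o) : rcauchy u -> exists l, rcvg u l.
Proof.
move=> uc.
have normE (z : R[i]^o) : rnorm z = Normc.normc z by [].
have sub (f : R[i] -> R) : (forall x y, f (x - y) = f x - f y) ->
    (forall z, `|f z| <= Normc.normc z) -> exists l : R, (f \o u) @ \oo --> l.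
  move=> fB fle; suff /cvg_ex[l fl] : cvg ((f \o u) @ \oo) by exists l.
  apply: cauchy_cvg; apply/cauchyP => e e0.
  have [N NP] := uc _ e0; exists (f (u N)), N => // n /= Nn.
  rewrite -ball_normE/= -fB; apply: le_lt_trans (fle _) _.
  by rewrite -normE; apply: NP.
have reE (z : R[i]) : `|Re z| <= Normc.normc z.
  case: z => a b /=; rewrite -sqrtr_sqr ler_wsqrtr// lerDl sqr_ge0//.
have imE (z : R[i]) : `|Im z| <= Normc.normc z.
  case: z => a b /=; rewrite -sqrtr_sqr ler_wsqrtr// lerDr sqr_ge0//.
have [|//|a /cvgrPdist_lt ua] := sub (@Re R); first by move=> [? ?] [? ?].
have [|//|b /cvgrPdist_lt ub] := sub (@Im R); first by move=> [? ?] [? ?].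
exists (a +i* b : R[i]) => e e0; have e20 : 0 < e / 2 by rewrite divr_gt0.
have [N _ NP] := ua _ e20; have [M _ MP] := ub _ e20.
exists (maxn N M) => n; rewrite geq_max => /andP[/NP/= + /MP/=].
rewrite normE; case: (u n) => c d /=.
rewrite (distrC a) (distrC b) => H1 H2.
have := le_normcD (c - a)%:C (0 +i* (d - b)).
rewrite /= !add0r !addr0 => /le_lt_trans; apply.
rewrite (_ : 0 ^+ 2 = 0) ?expr0n// addr0 add0r !sqrtr_sqr.
lra.
Qed.

End complex_complete.

Section bounded.
Context {R : realType} {X Y : normedModType R[i]}.

Lemma bounded_cont (f : X -> Y) : linear f ->
  (exists M : R, forall x, rnorm (f x) <= M * rnorm x) -> continuous f.
Proof.
move=> lf [M fM].
have fB x y : f (x - y) = f x - f y.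
  by have := lf (-1) y x; rewrite !scaleN1r (addrC x) (addrC (f x)).
move=> x; apply/cvgrPdist_lt => e /posC[e0 ->].
pose K := `|M| + 1; have K0 : 0 < K by rewrite ltr_wpDl.
have /nbhs_ballP : exists2 d : R[i], 0 < d & forall y, ball x d y ->
    ball (f x) (Re e)%:C (f y).
  exists (Re e / K)%:C; first by rewrite ltcR divr_gt0.
  move=> y /rnorm_ball xy; apply/rnorm_ball; rewrite -fB.
  apply: le_lt_trans (fM _) _; apply: (@le_lt_trans _ _ (K * rnorm (x - y))).
    rewrite ler_wpM2r ?rnorm_ge0// /K.
    by rewrite (le_trans (ler_norm M))// lerDl.
  by rewrite mulrC -ltr_pdivlMr.
by move=> xf; apply: filterS xf => y; rewrite -ball_normE.
Qed.

Lemma cont_bounded (f : X -> Y) : linear f -> continuous f ->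
  exists2 M : R, 0 <= M & forall x, rnorm (f x) <= M * rnorm x.
Proof.
move=> lf cf.
have fZ l x : f (l *: x) = l *: f x.
  have f0 : f 0 = 0 by have := lf (-1) 0 0; rewrite !scaleN1r !addNr.
  by have := lf l x 0; rewrite f0 !addr0.
have f0 : f 0 = 0 by have := fZ 0 0; rewrite !scale0r.
have /cvgrPdist_lt/(_ 1 ltr01) := cf 0.
rewrite f0 => /nbhs_ballP[d /posC[d0 ->] dP].
exists (Re d / 2)^-1; first by rewrite invr_ge0 ltW// divr_gt0.
move=> x; have [->|x0] := eqVneq x 0; first by rewrite f0 !rnorm0 mulr0.
have nx0 : 0 < rnorm x.
  by rewrite lt_def rnorm_ge0 andbT; apply: contra_neq x0; exact: rnorm0_eq0.
pose t : R := Re d / 2 / rnorm x.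
have t0 : 0 < t by rewrite !divr_gt0.
have tn : Normc.normc t%:C = t.
  by apply: complexI; rewrite -[LHS]/(`|t%:C|) ger0_norm// ler0c ltW.
have := dP (t%:C *: x); rewrite /= sub0r normrN rnormE (_ : 1 = 1%:C)// ltcR.
rewrite fZ rnormZ tn => H.
have : t * rnorm (f x) < 1.
  apply: H; apply/rnorm_ball; rewrite sub0r rnormN rnormZ tn.
  by rewrite /t divfK ?gt_eqF// ltr_pdivrMr// ltr_pMr// ltr1n.
move=> /ltW; rewrite -ler_pdivlMl// mulr1 => /le_trans; apply.
by rewrite /t invf_div mulrC.
Qed.

(* B(X, Y): continuous linear maps with the operator norm. *)
Definition bop_pred : {pred X -> Y} := fun f => `[< linear f /\ continuous f >].

Lemma bop_predP (f : X -> Y) : reflect (linear f /\ continuous f) (f \in bop_pred).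
Proof. exact: asboolP. Qed.

Lemma bop_submod : submod_closed bop_pred.
Proof.
split.
  apply/bop_predP; split; first by move=> l x y /=; rewrite scaler0 addr0.
  by move=> x; apply: cst_continuous.
move=> l f g /bop_predP[lf cf] /bop_predP[lg cg].
have [M M0 fM] := cont_bounded lf cf; have [N N0 gN] := cont_bounded lg cg.
have lfg : linear (l *: f + g).
  move=> k x y; rewrite !fctE lf lg !scalerDr !scalerA [k * l]mulrC.
  by rewrite addrACA.
apply/bop_predP; split=> //; apply: bounded_cont => //.
exists (Normc.normc l * M + N) => x; rewrite !fctE.
apply: le_trans (rnormD _ _) _; rewrite rnormZ mulrDl lerD// -mulrA.
by rewrite ler_wpM2l// -ler0c; exact: (normr_ge0 l).
Qed.

HB.instance Definition _ := GRing.isSubmodClosed.Build R[i] (X -> Y) bop_pred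
  bop_submod.

Record bop := Bop { bop_fun :> X -> Y ; bopP : bop_fun \in bop_pred }.

HB.instance Definition _ := [isSub for bop_fun].
HB.instance Definition _ := [Choice of bop by <:].
HB.instance Definition _ := [SubChoice_isSubLmodule of bop by <:].

End bounded.
Arguments bop {R} X Y.
Arguments bop_pred {R} X Y.

Section bop_norm.
Context {R : realType} {X Y : normedModType R[i]}.
Implicit Types f g : bop X Y.

Definition mkbop (f : X -> Y) (lf : linear f) (cf : continuous f) : bop X Y :=
  Bop (introT (bop_predP f) (conj lf cf)).

Lemma bop_linear f : linear f. Proof. by have /bop_predP[] := bopP f. Qed.
Lemma bop_cont f : continuous f. Proof. by have /bop_predP[] := bopP f. Qed.

HB.instance Definition _ f := GRing.isLinear.Build R[i] X Y _ (bop_fun f)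
  (@bop_linear f).

Lemma bop_ext f g : f =1 g -> f = g.
Proof. by move=> fg; apply: val_inj; apply/funext. Qed.

Lemma bopE f g x : (f + g) x = f x + g x. Proof. by []. Qed.
Lemma bopZ (l : R[i]) f x : (l *: f) x = l *: f x. Proof. by []. Qed.

Definition opnorm f : R := sup [set rnorm (f x) | x in [set x | rnorm x <= 1]].

Lemma bop_bounded f : exists2 M : R, 0 <= M & forall x, rnorm (f x) <= M * rnorm x.
Proof. exact: cont_bounded (bop_linear f) (@bop_cont f). Qed.

Lemma opnorm_has_sup f :
  has_sup [set rnorm (f x) | x in [set x | rnorm x <= 1]].
Proof.
split; first by exists (rnorm (f 0)), 0 => //=; rewrite rnorm0.
have [M M0 fM] := bop_bounded f; exists M => _ [x /= x1 <-].
by apply: le_trans (fM _) _; rewrite ler_piMr.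
Qed.

Lemma opnorm_le1 f x : rnorm x <= 1 -> rnorm (f x) <= opnorm f.
Proof.
by move=> x1; apply: ub_le_sup; [case: (opnorm_has_sup f)|exists x].
Qed.

Lemma opnorm_ge0 f : 0 <= opnorm f.
Proof. by apply: le_trans (opnorm_le1 f (x := 0) _); rewrite ?rnorm_ge0 ?rnorm0. Qed.

Lemma opnormP f x : rnorm (f x) <= opnorm f * rnorm x.
Proof.
have [->|x0] := eqVneq x 0; first by rewrite linear0 !rnorm0 mulr0.
have nx0 : 0 < rnorm x.
  by rewrite lt_def rnorm_ge0 andbT; apply: contra_neq x0; exact: rnorm0_eq0.
have tn : Normc.normc (rnorm x)^-1%:C = (rnorm x)^-1.
  apply: complexI; rewrite -[LHS]/(`|(rnorm x)^-1%:C|) ger0_norm// ler0c.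
  by rewrite invr_ge0 ltW.
have := @opnorm_le1 f ((rnorm x)^-1%:C *: x).
rewrite linearZ/= !rnormZ tn mulVf ?gt_eqF// => /(_ (lexx _)).
by rewrite ler_pdivrMl// mulrC.
Qed.

Lemma opnorm_ub f (M : R) : 0 <= M ->
  (forall x, rnorm (f x) <= M * rnorm x) -> opnorm f <= M.
Proof.
move=> M0 fM; apply: ge_sup; first by case: (opnorm_has_sup f).
by move=> _ [x /= x1 <-]; apply: le_trans (fM _) _; rewrite ler_piMr.
Qed.

Lemma opnormD f g : (opnorm (f + g))%:C <= (opnorm f)%:C + (opnorm g)%:C.
Proof.
rewrite -rmorphD lecR; apply: opnorm_ub => [|x]; first by rewrite addr_ge0 ?opnorm_ge0.
rewrite bopE; apply: le_trans (rnormD _ _) _.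
by rewrite mulrDl lerD ?opnormP.
Qed.

Lemma opnormZ (l : R[i]) f : (opnorm (l *: f))%:C = `|l| * (opnorm f)%:C.
Proof.
have n0 (k : R[i]) : 0 <= Normc.normc k by rewrite -ler0c; exact: (normr_ge0 k).
have H (k : R[i]) g : opnorm (k *: g) <= Normc.normc k * opnorm g.
  apply: opnorm_ub => [|x]; first by rewrite mulr_ge0 ?opnorm_ge0.
  by rewrite bopZ rnormZ -mulrA ler_wpM2l ?opnormP.
rewrite -[`|l|]/((Normc.normc l)%:C) -rmorphM; congr (_%:C).
apply/eqP; rewrite eq_le H/=; have [->|l0] := eqVneq l 0.
  by rewrite Normc.normc0 mul0r opnorm_ge0.
have := H l^-1 (l *: f); rewrite scalerA mulVf// scale1r Normc.normcV.
have nl0 : 0 < Normc.normc l.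
  by rewrite lt_def n0 andbT; apply: contra_neq l0; exact: Normc.eq0_normc.
by rewrite ler_pdivlMl.
Qed.

Lemma opnorm_eq0 f : (opnorm f)%:C = 0 -> f = 0.
Proof.
move=> /complexI f0; apply: bop_ext => x; apply: rnorm0_eq0; apply/eqP.
by rewrite eq_le rnorm_ge0 andbT; have := opnormP f x; rewrite f0 mul0r.
Qed.

HB.instance Definition _ := Lmodule_isNormed.Build R[i] (bop X Y)
  opnormD opnormZ opnorm_eq0.

Lemma bop_normE f : rnorm f = opnorm f. Proof. by []. Qed.

Definition seq_complete (Z : normedModType R[i]) :=
  forall u : nat -> Z, rcauchy u -> exists l, rcvg u l.

Lemma bop_seq_complete : seq_complete Y -> seq_complete (bop X Y).
Proof.
move=> hY u uc.
have uxc x : rcauchy (u ^~ x).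
  move=> e e0; have K0 : 0 < rnorm x + 1 by rewrite ltr_wpDl ?rnorm_ge0.
  have [N NP] := uc _ (divr_gt0 e0 K0).
  exists N => m n Nm Nn; have := NP _ _ Nm Nn; rewrite bop_normE => mn.
  rewrite -[_ - _]/((u m - u n) x); apply: le_lt_trans (opnormP _ _) _.
  rewrite ltr_pdivlMr// in mn; apply: le_lt_trans mn.
  by rewrite ler_wpM2l ?opnorm_ge0// lerDl.
have /choice[l ul] x := hY _ (uxc x).
have ll : linear l.
  move=> k x y; apply: (rcvg_unique (ul _)); apply/rcvgP.
  under eq_fun do rewrite linearP.
  by apply: cvgD; [apply: cvgZr|]; apply/rcvgP; exact: ul.
have lb (e : R) : 0 < e -> exists N, forall n, (N <= n)%N ->
    forall x, rnorm (u n x - l x) <= e * rnorm x.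
  move=> e0; have [N NP] := uc _ e0; exists N => n Nn x.
  apply/ler_addgt0Pr => d d0; have [M MP] := ul x _ d0.
  have := MP _ (leq_maxl M N); have := NP _ _ Nn (leq_maxr M N).
  set k := maxn _ _; rewrite bop_normE => nk kx.
  have -> : u n x - l x = (u n - u k) x + (u k x - l x).
    by rewrite -[(u n - u k) x]/(u n x - u k x) subrKA.
  apply: le_trans (rnormD _ _) _; apply: lerD; last exact: ltW.
  by apply: le_trans (opnormP _ _) _; rewrite ler_wpM2r ?rnorm_ge0 ?ltW.
have lc : continuous l.
  apply: bounded_cont => //; have [N /(_ _ (leqnn _)) NP] := lb 1 ltr01.
  exists (1 + opnorm (u N)) => x.
  have -> : l x = - (u N x - l x) + u N x by rewrite opprB subrK.
  apply: le_trans (rnormD _ _) _; rewrite rnormN mulrDl lerD ?NP//.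
  exact: opnormP.
exists (mkbop ll lc) => e e0; have [|N NP] := lb (e / 2); first by rewrite divr_gt0.
exists N => n Nn; rewrite bop_normE; apply: (@le_lt_trans _ _ (e / 2)).
  apply: opnorm_ub => [|x]; first by rewrite ltW// divr_gt0.
  exact: NP.
by rewrite ltr_pdivrMr// ltr_pMr// ltr1n.
Qed.

End bop_norm.

Definition dual {R : realType} (X : normedModType R[i]) : Type := bop X R[i]^o.

HB.instance Definition _ (R : realType) (X : normedModType R[i]) :=
  NormedModule.on (dual X).
HB.instance Definition _ (R : realType) (X : normedModType R[i]) :=
  Uniform_isComplete.Build (dual X)
    (rcomplete (bop_seq_complete (@complex_rcauchy R))).

Lemma normc_ge0 {R : realType} (l : R[i]) : 0 <= Normc.normc l.
Proof. by rewrite -ler0c; exact: (normr_ge0 l). Qed.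

Record seminorm {R : realType} (V : lmodType R[i]) := Seminorm {
  snorm :> V -> R ;
  snormD : forall u v, snorm (u + v) <= snorm u + snorm v ;
  snormZ : forall (l : R[i]) u, snorm (l *: u) = Normc.normc l * snorm u
}.

Section seminorm_theory.
Context {R : realType} {V : lmodType R[i]} (p : seminorm V).

Lemma snorm0 : p 0 = 0.
Proof. by have := snormZ p 0 0; rewrite scale0r Normc.normc0 mul0r. Qed.

Lemma snormN u : p (- u) = p u.
Proof. by rewrite -scaleN1r snormZ normcN Normc.normc1 mul1r. Qed.

Lemma snorm_ge0 u : 0 <= p u.
Proof.
have := snormD p u (- u); rewrite subrr snorm0 snormN -mulr2n.
by rewrite pmulrn_lge0.
Qed.

Lemma sdistC u v : p (u - v) = p (v - u).
Proof. by rewrite -snormN opprB. Qed.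

Lemma sdist_tri w u v : p (u - v) <= p (u - w) + p (w - v).
Proof. by apply: le_trans (snormD p _ _); rewrite subrKA. Qed.

Definition scauchy (u : nat -> V) := forall e : R, 0 < e ->
  exists N, forall m n, (N <= m)%N -> (N <= n)%N -> p (u m - u n) < e.

Definition scauchy_pred : {pred nat -> V} := fun u => `[< scauchy u >].

Lemma scauchy_predP u : reflect (scauchy u) (u \in scauchy_pred).
Proof. exact: asboolP. Qed.

Lemma scauchy_submod : submod_closed scauchy_pred.
Proof.
split; first by apply/scauchy_predP => e e0; exists 0%N => m n _ _; rewrite subr0 snorm0.
move=> l u v /scauchy_predP uc /scauchy_predP vc; apply/scauchy_predP => e e0.
have K0 : 0 < Normc.normc l + 1 by rewrite ltr_wpDl ?normc_ge0.
have e20 : 0 < e / 2 by rewrite divr_gt0.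
have [N NP] := uc _ (divr_gt0 e20 K0); have [M MP] := vc _ e20.
exists (maxn N M) => m n; rewrite !geq_max => /andP[Nm Mm] /andP[Nn Mn].
rewrite !fctE opprD addrACA -scalerBr.
apply: le_lt_trans (snormD _ _ _) _; rewrite [ltRHS]splitr ltr_leD ?ltW ?MP//.
have := NP _ _ Nm Nn; rewrite ltr_pdivlMr// snormZ => H.
apply: le_lt_trans H; rewrite mulrC ler_wpM2l ?snorm_ge0// lerDl//.
Qed.

HB.instance Definition _ := GRing.isSubmodClosed.Build R[i] (nat -> V)
  scauchy_pred scauchy_submod.

Record cseq := Cseq { cseq_fun :> nat -> V ; cseqP : cseq_fun \in scauchy_pred }.

HB.instance Definition _ := [isSub for cseq_fun].
HB.instance Definition _ := [Choice of cseq by <:].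
HB.instance Definition _ := [SubChoice_isSubLmodule of cseq by <:].

Implicit Types u v : cseq.

Lemma cseq_cauchy u : scauchy u. Proof. by have /scauchy_predP := cseqP u. Qed.

Lemma sdist_abs (x y : V) : `|p x - p y| <= p (x - y).
Proof.
rewrite ler_norml; apply/andP; split.
  by have := snormD p (y - x) x; rewrite subrK sdistC; lra.
by have := snormD p (x - y) y; rewrite subrK; lra.
Qed.

Definition cnorm u : R := lim ((p \o u) @ \oo).

Lemma cnorm_cvg u : (p \o u) @ \oo --> cnorm u.
Proof.
suff : cvg ((p \o u) @ \oo) by [].
apply: cauchy_cvg; apply/cauchyP => e e0.
have [N NP] := cseq_cauchy u e0; exists (p (u N)), N => // n /= Nn.
by rewrite -ball_normE/=; apply: le_lt_trans (sdist_abs _ _) _; apply: NP.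
Qed.

Lemma cnorm_near u (e : R) : 0 < e ->
  exists N, forall n, (N <= n)%N -> `|cnorm u - p (u n)| < e.
Proof.
by move=> e0; have /cvgrPdist_lt/(_ _ e0)[N _ NP] := @cnorm_cvg u; exists N.
Qed.

Lemma cnorm_le u (e : R) : (exists N, forall n, (N <= n)%N -> p (u n) <= e) ->
  cnorm u <= e.
Proof.
move=> [N NP]; apply/ler_addgt0Pr => d d0; have [M MP] := cnorm_near u d0.
have := NP _ (leq_maxl N M); have := MP _ (leq_maxr N M).
rewrite ltr_norml => /andP[_]; lra.
Qed.

Lemma cnorm_eq u v : (forall e : R, 0 < e -> exists N, forall n, (N <= n)%N ->
  p (u n - v n) <= e) -> cnorm u = cnorm v.
Proof.
move=> H; apply/eqP; rewrite eq_le; apply/andP; split;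
    apply/ler_addgt0Pr => e e0; have e20 : 0 < e / 2 by rewrite divr_gt0.
  have [N NP] := H _ e20; have [M MP] := cnorm_near v e20.
  apply: cnorm_le; exists (maxn N M) => n; rewrite geq_max => /andP[/NP Nn /MP].
  have := sdist_abs (u n) (v n).
  by rewrite ltr_norml ler_norml => /andP[_ ?] /andP[? _]; lra.
have [N NP] := H _ e20; have [M MP] := cnorm_near u e20.
apply: cnorm_le; exists (maxn N M) => n; rewrite geq_max => /andP[/NP Nn /MP].
have := sdist_abs (u n) (v n).
by rewrite ltr_norml ler_norml => /andP[? _] /andP[? _]; lra.
Qed.

Lemma cnormD u v : cnorm (u + v) <= cnorm u + cnorm v.
Proof.
apply/ler_addgt0Pr => e e0; have e20 : 0 < e / 2 by rewrite divr_gt0.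
have [N NP] := cnorm_near u e20; have [M MP] := cnorm_near v e20.
apply: cnorm_le; exists (maxn N M) => n; rewrite geq_max => /andP[/NP + /MP].
rewrite !ltr_norml => /andP[? _] /andP[? _]; have := snormD p (u n) (v n).
rewrite -[(u + v) n]/(u n + v n); lra.
Qed.

Lemma cnormZ (l : R[i]) u : cnorm (l *: u) = Normc.normc l * cnorm u.
Proof.
apply: cvg_lim => //.
have -> : p \o (l *: u : cseq) = (fun n => Normc.normc l * (p \o u) n).
  by apply/funext => n; rewrite /= -snormZ.
by apply: cvgMr; exact: cnorm_cvg.
Qed.

Lemma cnorm_ge0 u : 0 <= cnorm u.
Proof.
rewrite leNgt; apply/negP => u0; have [|N /(_ _ (leqnn _))] := @cnorm_near u (- cnorm u).
  by rewrite oppr_gt0.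
by rewrite ltr_norml => /andP[? _]; have := snorm_ge0 (u N); lra.
Qed.

Lemma cnormN u : cnorm (- u) = cnorm u.
Proof. by rewrite -scaleN1r cnormZ normcN Normc.normc1 mul1r. Qed.

Definition cnull : {pred cseq} := fun u => cnorm u == 0.

Lemma cnull_zmod : zmod_closed cnull.
Proof.
have cnorm0 : cnorm 0 = 0.
  by have := cnormZ 0 0; rewrite scale0r Normc.normc0 mul0r.
split=> [|u v]; first by rewrite unfold_in cnorm0.
rewrite !unfold_in => /eqP u0 /eqP v0; rewrite eq_le cnorm_ge0 andbT.
by apply: le_trans (cnormD _ _) _; rewrite cnormN u0 v0 addr0.
Qed.

HB.instance Definition _ := GRing.isZmodClosed.Build cseq cnull cnull_zmod.

(* Cauchy sequences modulo null sequences. *)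
Definition completion : Type := Quotient.quot cnull.

HB.instance Definition _ := GRing.Zmodule.on completion.

Local Open Scope quotient_scope.

Definition cpi u : completion := \pi_(Quotient.quot cnull) u.
Definition crepr (x : completion) : cseq := repr (x : Quotient.quot cnull).

Lemma creprK : cancel crepr cpi.
Proof. exact: reprK. Qed.

Lemma cpiD u v : cpi (u + v) = cpi u + cpi v.
Proof. exact: (@pi_addr _ _ _ _ _ (Quotient.quot cnull)). Qed.

Lemma cpiN u : cpi (- u) = - cpi u.
Proof. exact: (@pi_oppr _ _ _ _ _ (Quotient.quot cnull)). Qed.

Lemma cpiB u v : cpi (u - v) = cpi u - cpi v.
Proof. by rewrite cpiD cpiN. Qed.

Lemma cpi_eq u v : cpi u = cpi v <-> cnorm (u - v) = 0.
Proof.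
have := @Quotient.idealrBE _ cnull u v; rewrite unfold_in => E.
by split=> [uv|/eqP]; [apply/eqP; rewrite E; apply/eqP|rewrite E => /eqP].
Qed.

Lemma cnorm_repr u : cnorm (crepr (cpi u)) = cnorm u.
Proof.
have /cpi_eq E : cpi (crepr (cpi u)) = cpi u by rewrite creprK.
apply/eqP; rewrite eq_le; apply/andP; split.
  by rewrite -[X in cnorm X <= _](subrK u) (le_trans (cnormD _ _))// E add0r.
rewrite -[X in cnorm X <= _](subrK (crepr (cpi u))) (le_trans (cnormD _ _))//.
by rewrite -cnormN opprB E add0r.
Qed.

Definition cscale (l : R[i]) (x : completion) : completion := cpi (l *: crepr x).

Lemma cpiZ l u : cpi (l *: u) = cscale l (cpi u).
Proof.
apply/cpi_eq; rewrite -scalerBr cnormZ.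
have /cpi_eq -> : cpi u = cpi (crepr (cpi u)) by rewrite creprK.
by rewrite mulr0.
Qed.

Lemma cscaleA a b x : cscale a (cscale b x) = cscale (a * b) x.
Proof. by rewrite -(creprK x) -!cpiZ scalerA. Qed.

Lemma cscale1 : left_id 1 cscale.
Proof. by move=> x; rewrite -(creprK x) -!cpiZ scale1r. Qed.

Lemma cscaleDr : right_distributive cscale +%R.
Proof.
by move=> a x y; rewrite -(creprK x) -(creprK y) -cpiD -!cpiZ scalerDr cpiD.
Qed.

Lemma cscaleDl x : {morph cscale^~ x : a b / a + b}.
Proof. by move=> a b; rewrite -(creprK x) -!cpiZ scalerDl cpiD. Qed.

HB.instance Definition _ := GRing.Zmodule_isLmodule.Build R[i] completion
  cscaleA cscale1 cscaleDr cscaleDl.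

Definition completion_norm (x : completion) : R[i] := (cnorm (crepr x))%:C.

Lemma completion_normD x y :
  completion_norm (x + y) <= completion_norm x + completion_norm y.
Proof.
rewrite /completion_norm -rmorphD lecR -{1}(creprK x) -{1}(creprK y) -cpiD.
by rewrite cnorm_repr cnormD.
Qed.

Lemma completion_normZ l x :
  completion_norm (l *: x) = `|l| * completion_norm x.
Proof.
rewrite /completion_norm -[`|l|]/((Normc.normc l)%:C) -rmorphM -cnormZ.
by rewrite -[l *: x]/(cpi (l *: crepr x)) cnorm_repr.
Qed.

Lemma completion_norm_eq0 x : completion_norm x = 0 -> x = 0.
Proof.
move=> /complexI x0; rewrite -(creprK x) -(subrr (cpi 0)) -cpiB; apply/cpi_eq.
by rewrite subrr subr0.
Qed.

HB.instance Definition _ := Lmodule_isNormed.Build R[i] completion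
  completion_normD completion_normZ completion_norm_eq0.

Lemma completion_normE u : rnorm (cpi u) = cnorm u.
Proof. exact: cnorm_repr. Qed.

Lemma cst_cauchy (v : V) : (fun _ : nat => v) \in scauchy_pred.
Proof. by apply/scauchy_predP => e e0; exists 0%N => *; rewrite subrr snorm0. Qed.

Definition cinj (v : V) : completion := cpi (Cseq (cst_cauchy v)).

Lemma cinj_norm (v : V) : rnorm (cinj v) = p v.
Proof.
rewrite completion_normE; apply: cvg_lim => //.
have -> : p \o Cseq (cst_cauchy v) = cst (p v) by [].
exact: cvg_cst.
Qed.

Lemma cinj_linear : linear cinj.
Proof.
move=> l u v; rewrite -[l *: cinj u]cpiZ -cpiD; congr cpi.
exact: val_inj.
Qed.

HB.instance Definition _ := GRing.isLinear.Build R[i] V completion _ cinj cinj_linear.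

Lemma cinj_cvg u : rcvg (fun n => cinj (u n)) (cpi u).
Proof.
move=> e e0; have e20 : 0 < e / 2 by rewrite divr_gt0.
have [N NP] := cseq_cauchy u e20; exists N => n Nn.
rewrite -cpiB completion_normE; apply: (@le_lt_trans _ _ (e / 2)); last first.
  by rewrite ltr_pdivrMr// ltr_pMr// ltr1n.
by apply: cnorm_le; exists N => m Nm; apply/ltW; apply: NP.
Qed.

Lemma cinj_dense (x : completion) (e : R) : 0 < e ->
  exists v : V, rnorm (cinj v - x) < e.
Proof.
move=> e0; have [N NP] := cinj_cvg (crepr x) e0; exists (crepr x N).
by have := NP _ (leqnn _); rewrite creprK.
Qed.

Lemma completion_complete (x : nat -> completion) :
  rcauchy x -> exists l, rcvg x l.
Proof.
move=> xc.
have /choice[v vP] (n : nat) : exists v : V, rnorm (cinj v - x n) < n.+1%:R^-1.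
  by apply: cinj_dense; rewrite invr_gt0 ltr0n.
have small (e : R) : 0 < e -> exists N, forall n, (N <= n)%N ->
    rnorm (cinj (v n) - x n) < e.
  move=> e0; have /cvgrPdist_lt/(_ _ e0)[N _ NP] := @cvg_harmonic R.
  exists N => n /NP/=; rewrite sub0r normrN ger0_norm ?invr_ge0//.
  exact: lt_trans.
have vc : v \in scauchy_pred.
  apply/scauchy_predP => e e0; have e40 : 0 < e / 4 by rewrite divr_gt0.
  have [N NP] := small _ e40; have [M MP] := xc _ e40.
  exists (maxn N M) => m n; rewrite !geq_max => /andP[Nm Mm] /andP[Nn Mn].
  rewrite -cinj_norm linearB/=.
  have -> : cinj (v m) - cinj (v n) = (cinj (v m) - x m) + (x m - x n)
      + - (cinj (v n) - x n) by rewrite subrKA opprB subrKA.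
  have := NP _ Nm; have := NP _ Nn; have := MP _ _ Mm Mn.
  have := rnormD (cinj (v m) - x m + (x m - x n)) (- (cinj (v n) - x n)).
  have := rnormD (cinj (v m) - x m) (x m - x n); rewrite rnormN; lra.
exists (cpi (Cseq vc)) => e e0; have e20 : 0 < e / 2 by rewrite divr_gt0.
have [N NP] := small _ e20; have [M MP] := cinj_cvg (Cseq vc) e20.
exists (maxn N M) => n; rewrite geq_max => /andP[/NP + /MP/=].
have -> : x n - cpi (Cseq vc) =
  - (cinj (v n) - x n) + (cinj (v n) - cpi (Cseq vc)) by rewrite opprB subrKA.
have := rnormD (- (cinj (v n) - x n)) (cinj (v n) - cpi (Cseq vc)).
rewrite rnormN; lra.
Qed.

HB.instance Definition _ := Uniform_isComplete.Build completion
  (rcomplete completion_complete).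

End seminorm_theory.

Section extension.
Context {R : realType} {V : lmodType R[i]} (p : seminorm V).
Context {Z : normedModType R[i]} (f : V -> Z).

(* Extension by continuity of [f] along [cinj]. *)
Definition cext (x : completion p) : Z := lim ((fun n => f (crepr x n)) @ \oo).

Hypothesis hZ : seq_complete Z.
Hypothesis lf : linear f.
Variable M : R.
Hypothesis M0 : 0 <= M.
Hypothesis fM : forall v, rnorm (f v) <= M * p v.

Let fB x y : f (x - y) = f x - f y.
Proof. by have := lf (-1) y x; rewrite !scaleN1r (addrC x) (addrC (f x)). Qed.

Lemma cext_cvg (x : completion p) : rcvg (fun n => f (crepr x n)) (cext x).
Proof.
have [l fl] : exists l, rcvg (fun n => f (crepr x n)) l.
  apply: hZ => e e0; have K0 : 0 < M + 1 by rewrite ltr_wpDl.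
  have [N NP] := cseq_cauchy (crepr x) (divr_gt0 e0 K0).
  exists N => m n Nm Nn; rewrite -fB; apply: le_lt_trans (fM _) _.
  have := NP _ _ Nm Nn; rewrite ltr_pdivlMr//; apply: le_lt_trans.
  by rewrite mulrC ler_wpM2l ?snorm_ge0// lerDl.
by rewrite /cext (rcvg_lim fl).
Qed.

Lemma cext_cpi (u : cseq p) l : rcvg (fun n => f (u n)) l -> cext (cpi u) = l.
Proof.
move=> ul; have cl := @cext_cvg (cpi u).
apply: (rcvg_unique _ ul); apply/rcvgP.
have d0 : rcvg (fun n => f (crepr (cpi u) n - u n)) 0.
  move=> e e0; have K0 : 0 < M + 1 by rewrite ltr_wpDl.
  have E : cnorm (crepr (cpi u) - u) = 0 by apply/cpi_eq; rewrite creprK.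
  have [N NP] := cnorm_near (crepr (cpi u) - u) (divr_gt0 e0 K0).
  exists N => n /NP; rewrite E subr0 sub0r normrN ger0_norm ?snorm_ge0// => H.
  apply: le_lt_trans (fM _) _; rewrite ltr_pdivlMr// in H.
  by apply: le_lt_trans H; rewrite mulrC ler_wpM2l ?snorm_ge0// lerDl.
have -> : (fun n => f (u n)) =
    (fun n => f (crepr (cpi u) n) - f (crepr (cpi u) n - u n)).
  by apply/funext => n; rewrite fB subKr.
by rewrite -[cext _]subr0; apply: cvgB; apply/rcvgP.
Qed.

Lemma cext_cinj v : cext (cinj p v) = f v.
Proof. by apply: cext_cpi => e e0; exists 0%N => n _; rewrite subrr rnorm0. Qed.

Lemma cext_linear : linear cext.
Proof.
move=> l x y; rewrite -{1}(creprK x) -{1}(creprK y) -[l *: _]cpiZ -cpiD.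
apply: cext_cpi; apply/rcvgP.
have -> : (fun n => f ((l *: crepr x + crepr y : cseq p) n)) =
   (fun n => l *: f (crepr x n) + f (crepr y n)).
  by apply/funext => n; rewrite -lf.
by apply: cvgD; [apply: cvgZr|]; apply/rcvgP; exact: cext_cvg.
Qed.

Lemma cext_bounded x : rnorm (cext x) <= M * rnorm x.
Proof.
apply/ler_addgt0Pr => e e0; have e20 : 0 < e / 2 by rewrite divr_gt0.
have K0 : 0 < M + 1 by rewrite ltr_wpDl.
have [N NP] := cext_cvg x e20.
have [K KP] := cnorm_near (crepr x) (divr_gt0 e20 K0).
have := NP _ (leq_maxl N K); have := KP _ (leq_maxr N K).
set k := maxn _ _; rewrite -(completion_normE (crepr x)) creprK.
rewrite ltr_norml => /andP[+ _]; rewrite ltrNl opprB ltr_pdivlMr// => H1 H2.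
have H3 := fM (crepr x k).
have -> : cext x = f (crepr x k) - (f (crepr x k) - cext x) by rewrite subKr.
apply: le_trans (rnormD _ _) _; rewrite rnormN.
have : M * (p (crepr x k) - rnorm x) <= e / 2.
  have [H|H] := leP 0 (p (crepr x k) - rnorm x).
    by apply: le_trans (ltW H1); rewrite mulrC ler_wpM2l// lerDl.
  by apply: le_trans (ltW e20); rewrite mulr_ge0_le0// ltW.
by rewrite mulrBr; lra.
Qed.

End extension.

Section separation.
Context {K : fieldType} {Z : lmodType K}.

Let subspace (H : set Z) := H 0 /\ forall (l : K) x y, H x -> H y -> H (l *: x + y).

(* Linear (not nec. continuous) functionals separate points. *)
Lemma linear_separation (z : Z) : z <> 0 ->
  exists2 f : Z -> K^o, linear f & f z = 1.
Proof.
move=> z0; pose Q (H : set Z) := subspace H /\ ~ H z; pose T := {H : set Z | Q H}.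
have [H Hmax] : exists H : T, forall G : T, `[< sval H `<=` sval G >] -> G = H.
  apply: (@Zorn T (fun H G => `[< sval H `<=` sval G >])).
  - by move=> H; apply/asboolP.
  - by move=> H G I /asboolP HG /asboolP GI; apply/asboolP; exact: subset_trans GI.
  - move=> [H pH] [G pG] /asboolP/= HG /asboolP/= GH; apply: eq_exist.
    exact/seteqP.
  move=> A Atot; have [[H0 AH0]|nA] := pselect (exists H, A H); last first.
    have s0 : subspace [set 0] /\ ~ [set 0] z.
      by split=> //; split=> // l x y -> ->; rewrite /= scaler0 addr0.
    exists (exist Q _ s0) => H AH; exfalso; apply: nA; by exists H.
  pose U : set Z := [set x | exists2 H : T, A H & sval H x].
  have sU : subspace U /\ ~ U z.
    split; last by move=> [H _]; case: (svalP H).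
    split; first by exists H0 => //; case: (svalP H0) => -[].
    move=> l x y [H AH Hx] [G AG Gy].
    have [/asboolP HG|/asboolP GH] := Atot _ _ AH AG.
      by exists G => //; have [[_]+ _] := svalP G; apply => //; exact: HG.
    by exists H => //; have [[_]+ _] := svalP H; apply => //; exact: GH.
  by exists (exist Q _ sU) => H AH; apply/asboolP => x Hx; exists H.
have [[H0 Hlin] Hz] := svalP H.
have HN x : sval H x -> sval H (- x).
  by move=> Hx; have := Hlin (-1) x 0 Hx H0; rewrite scaleN1r addr0.
have HD x y : sval H x -> sval H y -> sval H (x + y).
  by move=> Hx Hy; have := Hlin 1 x y Hx Hy; rewrite scale1r.
have HZ l x : sval H x -> sval H (l *: x).
  by move=> Hx; have := Hlin l x 0 Hx H0; rewrite addr0.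
have uniq c : sval H (c *: z) -> c = 0.
  move=> Hc; apply: contrapT => /eqP c0; apply: Hz.
  by have := HZ c^-1 _ Hc; rewrite scalerA mulVf// scale1r.
have /choice[f fP] x : exists c, sval H (x - c *: z).
  have [Hx|nHx] := pselect (sval H x); first by exists 0; rewrite scale0r subr0.
  apply: contrapT => nc.
  pose G : set Z := [set y | exists c, sval H (y - c *: x)].
  have sG : subspace G /\ ~ G z.
    split; last first.
      move=> [c Hc]; apply: nc; have c0 : c != 0.
        by apply/eqP => c0; apply: Hz; rewrite c0 scale0r subr0 in Hc.
      exists c^-1; have := HN _ (HZ c^-1 _ Hc).
      by rewrite scalerBr scalerA mulVf// scale1r opprB.
    split; first by exists 0; rewrite scale0r subr0.
    move=> l u v [c Hc] [d Hd]; exists (l * c + d).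
    have := Hlin l _ _ Hc Hd; rewrite scalerBr addrACA -opprD scalerA.
    by rewrite scalerDl.
  have : sval H x.
    rewrite -(Hmax (exist Q _ sG)) /=; first by exists 1; rewrite scale1r subrr.
    by apply/asboolP => y Hy; exists 0; rewrite scale0r subr0.
  exact: nHx.
have fE x c : sval H (x - c *: z) -> f x = c.
  move=> Hc; apply/eqP; rewrite -subr_eq0; apply/eqP/uniq.
  have := HD _ _ Hc (HN _ (fP x)); rewrite opprB addrC subrKA.
  by rewrite -scalerBl.
exists f; last by apply: fE; rewrite scale1r subrr.
move=> l x y; apply: fE; have := Hlin l _ _ (fP x) (fP y).
by rewrite scalerBr addrACA -opprD scalerA -scalerDl.
Qed.

End separation.

Section tensor.
Context {R : realType} {V W : lmodType R[i]}.

Definition bilinear_map {Z : lmodType R[i]} (B : V -> W -> Z) :=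
  (forall w, linear (B ^~ w)) /\ (forall v, linear (B v)).

Record bilform := Bilform {
  bilform_fun :> V -> W -> R[i]^o ;
  bilformP : bilinear_map bilform_fun
}.

Definition tensor_pred : {pred bilform -> R[i]^o} := fun F =>
  `[< exists s : seq (V * W), F = fun b => \sum_(x <- s) b x.1 x.2 >].

Lemma tensor_predP (F : bilform -> R[i]^o) : reflect
  (exists s : seq (V * W), F = fun b => \sum_(x <- s) b x.1 x.2)
  (F \in tensor_pred).
Proof. exact: asboolP. Qed.

Lemma tensor_submod : submod_closed tensor_pred.
Proof.
split; first by apply/tensor_predP; exists [::]; apply/funext => b; rewrite big_nil.
move=> l _ _ /tensor_predP[s ->] /tensor_predP[t ->].
apply/tensor_predP; exists ([seq (l *: x.1, x.2) | x <- s] ++ t).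
apply/funext => b; rewrite big_cat/= big_map !fctE; congr (_ + _).
rewrite [LHS]scaler_sumr; apply: eq_bigr => x _ /=.
have [bl _] := bilformP b; have b0 : b 0 x.2 = 0.
  by have := bl x.2 (-1) 0 0; rewrite !scaleN1r !addNr.
by have := bl x.2 l x.1 0; rewrite b0 !addr0.
Qed.

HB.instance Definition _ := GRing.isSubmodClosed.Build R[i] (bilform -> R[i]^o)
  tensor_pred tensor_submod.

(* The algebraic tensor product, as the space of linear functionals on the
   bilinear forms on V x W spanned by the evaluations at the points of V x W. *)
Record tensor := Tensor {
  tensor_fun :> bilform -> R[i]^o ;
  tensorP : tensor_fun \in tensor_pred
}.

HB.instance Definition _ := [isSub for tensor_fun].
HB.instance Definition _ := [Choice of tensor by <:].
HB.instance Definition _ := [SubChoice_isSubLmodule of tensor by <:].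

(* \sum_i v_i (x) w_i *)
Definition tsum (s : seq (V * W)) : tensor :=
  Tensor (introT (tensor_predP _) (ex_intro _ s erefl)).

Lemma tsum_surj u : exists s, u = tsum s.
Proof. by have /tensor_predP[s us] := tensorP u; exists s; apply: val_inj. Qed.

Lemma tsum_cat s t : tsum (s ++ t) = tsum s + tsum t.
Proof. by apply: val_inj; apply/funext => b /=; rewrite big_cat. Qed.

Lemma tsum_nil : tsum [::] = 0.
Proof. by apply: val_inj; apply/funext => b /=; rewrite big_nil. Qed.

Lemma tsumZ (l : R[i]) s : tsum [seq (l *: x.1, x.2) | x <- s] = l *: tsum s.
Proof.
apply: val_inj; apply/funext => b /=; rewrite big_map [RHS]scaler_sumr.
apply: eq_bigr => x _ /=.
have [bl _] := bilformP b; have b0 : b 0 x.2 = 0.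
  by have := bl x.2 (-1) 0 0; rewrite !scaleN1r !addNr.
by have := bl x.2 l x.1 0; rewrite b0 !addr0.
Qed.

Lemma tsum1_bilinear : bilinear_map (fun v w => tsum [:: (v, w)]).
Proof.
split=> [w l v v'|v l w w']; apply: val_inj; apply/funext => b /=.
  by rewrite !fctE /= !big_seq1/=; have [+ _] := bilformP b; apply.
by rewrite !fctE /= !big_seq1/=; have [_ +] := bilformP b; apply.
Qed.

Definition trep (u : tensor) : seq (V * W) := sval (cid (tsum_surj u)).

Lemma trepK u : tsum (trep u) = u.
Proof. by rewrite /trep; case: cid. Qed.

(* The linear map on the tensor product induced by a bilinear map. *)
Definition tlift {Z : lmodType R[i]} (B : V -> W -> Z) (u : tensor) : Z :=
  \sum_(x <- trep u) B x.1 x.2.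

Lemma tlift_tsum (Z : lmodType R[i]) (B : V -> W -> Z) s : bilinear_map B ->
  tlift B (tsum s) = \sum_(x <- s) B x.1 x.2.
Proof.
move=> [Bl Br]; rewrite /tlift; set t := trep _.
have st : tsum t = tsum s by rewrite trepK.
apply: contrapT => /eqP; rewrite -subr_eq0 => /eqP/linear_separation[f lf].
have fD x y : f (x + y) = f x + f y by have := lf 1 x y; rewrite !scale1r.
have fN x : f (- x) = - f x.
  have f0 : f 0 = 0 by have := lf (-1) 0 0; rewrite !scaleN1r !addNr.
  by have := lf (-1) x 0; rewrite !scaleN1r f0 !addr0.
have f0 : f 0 = 0 by have := lf (-1) 0 0; rewrite !scaleN1r !addNr.
have bb : bilinear_map (fun v w => f (B v w)).
  by split=> [w l v v'|v l w w'] /=; rewrite (Bl, Br) lf.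
have fsum (r : seq (V * W)) : f (\sum_(x <- r) B x.1 x.2) = tsum r (Bilform bb).
  by rewrite (big_morph f fD f0).
rewrite fD fN !fsum st subrr => /esym/eqP; by rewrite oner_eq0.
Qed.

Lemma tlift_linear (Z : lmodType R[i]) (B : V -> W -> Z) : bilinear_map B ->
  linear (tlift B).
Proof.
move=> bB l u v; rewrite -(trepK u) -(trepK v) -tsumZ -tsum_cat !tlift_tsum//.
rewrite big_cat/= big_map scaler_sumr; congr (_ + _); apply: eq_bigr => x _ /=.
have [Bl _] := bB; have B0 : B 0 x.2 = 0.
  by have := Bl x.2 (-1) 0 0; rewrite !scaleN1r !addNr.
by have := Bl x.2 l x.1 0; rewrite B0 !addr0.
Qed.

End tensor.
Arguments tensor {R} V W.

Section projective.
Context {R : realType} {X Y : normedModType R[i]}.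
Implicit Types u v : tensor X Y.

Definition tcost (s : seq (X * Y)) : R := \sum_(x <- s) rnorm x.1 * rnorm x.2.

(* The projective norm; it is only shown to be a seminorm, and the completion
   below separates it. *)
Definition pnorm u : R := inf [set tcost s | s in [set s | u = tsum s]].

Lemma tcost_ge0 s : 0 <= tcost s.
Proof. by apply: sumr_ge0 => x _; rewrite mulr_ge0 ?rnorm_ge0. Qed.

Lemma pnorm_has_inf u : has_inf [set tcost s | s in [set s | u = tsum s]].
Proof.
split; first by have [s us] := tsum_surj u; exists (tcost s), s.
by exists 0 => _ [s _ <-]; exact: tcost_ge0.
Qed.

Lemma pnorm_le s : pnorm (tsum s) <= tcost s.
Proof. by apply: ge_inf; [case: (pnorm_has_inf (tsum s))|exists s]. Qed.

Lemma pnorm_approx u (e : R) : 0 < e ->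
  exists2 s, u = tsum s & tcost s < pnorm u + e.
Proof.
move=> e0; have [_ [s us <-] H] := inf_adherent e0 (pnorm_has_inf u).
by exists s.
Qed.

Lemma pnormD u v : pnorm (u + v) <= pnorm u + pnorm v.
Proof.
apply/ler_addgt0Pr => e e0; have e20 : 0 < e / 2 by rewrite divr_gt0.
have [s us sc] := pnorm_approx u e20; have [t vt tc] := pnorm_approx v e20.
rewrite {1}us {1}vt -tsum_cat; apply: le_trans (pnorm_le _) _.
rewrite /tcost big_cat/= -!/(tcost _); lra.
Qed.

Lemma pnorm_ge0 u : 0 <= pnorm u.
Proof.
apply: lb_le_inf; first by case: (pnorm_has_inf u).
by move=> _ [s _ <-]; exact: tcost_ge0.
Qed.

Lemma pnormZ (l : R[i]) u : pnorm (l *: u) = Normc.normc l * pnorm u.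
Proof.
have H (k : R[i]) v : pnorm (k *: v) <= Normc.normc k * pnorm v.
  apply/ler_addgt0Pr => e e0.
  have K0 : 0 < Normc.normc k + 1 by rewrite ltr_wpDl ?normc_ge0.
  have [s vs sc] := pnorm_approx v (divr_gt0 e0 K0).
  rewrite {1}vs -tsumZ; apply: le_trans (pnorm_le _) _.
  have -> : tcost [seq (k *: x.1, x.2) | x <- s] = Normc.normc k * tcost s.
    rewrite /tcost big_map mulr_sumr; apply: eq_bigr => x _ /=.
    by rewrite rnormZ mulrA.
  apply: (@le_trans _ _ (Normc.normc k * (pnorm v + e / (Normc.normc k + 1)))).
    by rewrite ler_wpM2l ?normc_ge0// ltW.
  rewrite mulrDr lerD2l mulrCA ler_piMr// ?ltW// ltr_pdivrMr// mul1r ltrDl//.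
apply/eqP; rewrite eq_le H/=; have [->|l0] := eqVneq l 0.
  by rewrite Normc.normc0 mul0r pnorm_ge0.
have := H l^-1 (l *: u); rewrite scalerA mulVf// scale1r Normc.normcV.
have nl0 : 0 < Normc.normc l.
  by rewrite lt_def normc_ge0 andbT; apply: contra_neq l0; exact: Normc.eq0_normc.
by rewrite ler_pdivlMl.
Qed.

Definition projective_seminorm : seminorm (tensor X Y) := Seminorm pnormD pnormZ.

End projective.

Section ptensor.
Context {R : realType}.

(* The projective tensor product: completion of the algebraic tensor product
   for the projective norm. *)
Definition ptensor (X Y : normedModType R[i]) : Type :=
  completion (@projective_seminorm R X Y).

HB.instance Definition _ X Y := CompleteNormedModule.on (ptensor X Y).

Context {X Y : normedModType R[i]}.

Definition tens (x : X) (y : Y) : ptensor X Y :=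
  cinj projective_seminorm (tsum [:: (x, y)]).

Lemma tens_bilinear : bilinear_map tens.
Proof.
have [Tl Tr] := @tsum1_bilinear R X Y.
by split=> [w l v v'|v l w w']; rewrite /tens (Tl, Tr) linearP.
Qed.

Lemma tens_norm x y : rnorm (tens x y) <= rnorm x * rnorm y.
Proof.
by rewrite cinj_norm; apply: le_trans (pnorm_le _) _; rewrite /tcost big_seq1.
Qed.

Lemma tens_sum s : cinj projective_seminorm (tsum s) =
  \sum_(x <- s) tens x.1 x.2 :> ptensor X Y.
Proof.
elim: s => [|[x y] s IH]; first by rewrite big_nil tsum_nil linear0.
by rewrite big_cons -cat1s tsum_cat linearD/= IH.
Qed.

Lemma ptensor_dense (u : ptensor X Y) (e : R) : 0 < e ->
  exists s : seq (X * Y), rnorm (\sum_(x <- s) tens x.1 x.2 - u) < e.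
Proof.
move=> e0; have [v] := cinj_dense u e0.
by rewrite -(trepK v) tens_sum; exists (trep v).
Qed.

Lemma ptensor_ext (Z : normedModType R[i]) (f g : bop (ptensor X Y) Z) :
  (forall x y, f (tens x y) = g (tens x y)) -> f = g.
Proof.
move=> fg; apply/eqP; rewrite -subr_eq0; apply/eqP; apply: bop_ext => u.
set h := f - g; have hs s : h (\sum_(x <- s) tens x.1 x.2) = 0.
  rewrite linear_sum big1// => x _.
  by rewrite -[LHS]/(f (tens _ _) - g (tens _ _)) fg subrr.
apply: rnorm0_eq0; apply/eqP; rewrite eq_le rnorm_ge0 andbT.
apply/ler_addgt0Pr => e e0; rewrite add0r.
have K0 : 0 < opnorm h + 1 by rewrite ltr_wpDl ?opnorm_ge0.
have [s sP] := ptensor_dense u (divr_gt0 e0 K0).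
have -> : h u = - h (\sum_(x <- s) tens x.1 x.2 - u).
  have hB a b : h (a - b) = h a - h b by exact: linearB.
  by rewrite hB hs sub0r opprK.
rewrite rnormN; apply: le_trans (opnormP _ _) _; rewrite ltr_pdivlMr// in sP.
apply: ltW; apply: le_lt_trans sP; rewrite mulrC ler_wpM2l ?rnorm_ge0//.
by rewrite lerDl.
Qed.

Section plift.
Context {Z : normedModType R[i]} (B : X -> Y -> Z).

(* The continuous linear map with x (x) y |-> B x y, for B bilinear and bounded. *)
Definition plift : ptensor X Y -> Z := cext (tlift B).

Hypothesis hZ : seq_complete Z.
Hypothesis bB : bilinear_map B.
Variable M : R.
Hypothesis M0 : 0 <= M.
Hypothesis BM : forall x y, rnorm (B x y) <= M * rnorm x * rnorm y.

Let tliftM (u : tensor X Y) : rnorm (tlift B u) <= M * projective_seminorm u.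
Proof.
apply/ler_addgt0Pr => e e0; have K0 : 0 < M + 1 by rewrite ltr_wpDl.
have [s us sc] := pnorm_approx u (divr_gt0 e0 K0); rewrite {1}us tlift_tsum//.
apply: (@le_trans _ _ (M * tcost s)).
  rewrite /tcost mulr_sumr; elim: s {us sc} => [|x s IH].
    by rewrite !big_nil rnorm0.
  by rewrite !big_cons; apply: le_trans (rnormD _ _) _; rewrite lerD// mulrA.
apply: (@le_trans _ _ (M * (pnorm u + e / (M + 1)))).
  by rewrite ler_wpM2l// ltW.
rewrite mulrDr lerD2l mulrCA ler_piMr// ?ltW// ltr_pdivrMr// mul1r ltrDl//.
Qed.

Lemma plift_tens x y : plift (tens x y) = B x y.
Proof.
by rewrite /plift (cext_cinj hZ (tlift_linear bB) M0)// tlift_tsum// big_seq1.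
Qed.

Lemma plift_linear : linear plift.
Proof. exact: (cext_linear hZ (tlift_linear bB) M0). Qed.

Lemma plift_bounded u : rnorm (plift u) <= M * rnorm u.
Proof. exact: (cext_bounded hZ (tlift_linear bB) M0). Qed.

Lemma plift_cont : continuous plift.
Proof. by apply: bounded_cont plift_linear _; exists M => u; exact: plift_bounded. Qed.

End plift.
End ptensor.

(* Banach algebras over R[i], not necessarily unital. *)
HB.mixin Record isBanachAlgebra (R : realType) U
    & CompleteNormedModule R[i] U := {
  amul : U -> U -> U ;
  amulA : forall a b c, amul a (amul b c) = amul (amul a b) c ;
  amul_linearl : forall b, linear (amul ^~ b) ;
  amul_linearr : forall a, linear (amul a) ;
  amul_norm : forall a b, `|amul a b| <= `|a| * `|b|
}.

#[short(type="banachAlgType")]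
HB.structure Definition BanachAlgebra (R : realType) :=
  {U of isBanachAlgebra R U & CompleteNormedModule R[i] U}.

(* The actions are only required to be bounded, not contractive. *)
HB.mixin Record isBanachBimodule (R : realType) (U : banachAlgType R) X
    & CompleteNormedModule R[i] X := {
  lact : U -> X -> X ;
  ract : X -> U -> X ;
  lact_linearl : forall x, linear (lact ^~ x) ;
  lact_linearr : forall a, linear (lact a) ;
  ract_linearl : forall a, linear (ract ^~ a) ;
  ract_linearr : forall x, linear (ract x) ;
  lactA : forall a b x, lact a (lact b x) = lact (amul a b) x ;
  ractA : forall x a b, ract (ract x a) b = ract x (amul a b) ;
  lractA : forall a x b, ract (lact a x) b = lact a (ract x b) ;
  lact_bounded : exists M : R[i], forall a x, `|lact a x| <= M * `|a| * `|x| ;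
  ract_bounded : exists M : R[i], forall x a, `|ract x a| <= M * `|x| * `|a|
}.

#[short(type="banachBimodType")]
HB.structure Definition BanachBimodule (R : realType) (U : banachAlgType R) :=
  {X of isBanachBimodule R U X & CompleteNormedModule R[i] X}.

Lemma complete_seq_complete {R : realType} (Z : completeNormedModType R[i]) :
  seq_complete Z.
Proof. by move=> u /rcauchy_cvg. Qed.

Lemma amul_rnorm {R : realType} {U : banachAlgType R} (a b : U) :
  rnorm (amul a b) <= rnorm a * rnorm b.
Proof. by rewrite -lecR rmorphM/= -!rnormE amul_norm. Qed.

Lemma bound_rnorm {R : realType} {X Y Z : normedModType R[i]} (B : X -> Y -> Z) :
  (exists M : R[i], forall x y, `|B x y| <= M * `|x| * `|y|) ->
  exists2 M : R, 0 <= M & forall x y, rnorm (B x y) <= M * rnorm x * rnorm y.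
Proof.
move=> [M BM]; exists (Normc.normc M) => [|x y]; first exact: normc_ge0.
have := BM x y; rewrite !rnormE => H.
have H1 : (rnorm (B x y))%:C <= `|M * (rnorm x)%:C * (rnorm y)%:C|.
  by rewrite ger0_norm//; apply: le_trans H; rewrite ler0c rnorm_ge0.
rewrite -lecR !rmorphM/=; move: H1; rewrite !normrM !(@ger0_norm _ _%:C) ?ler0c ?rnorm_ge0//.
Qed.

Section dual_bimodule.
Context {R : realType} {U : banachAlgType R} {X : banachBimodType U}.

Lemma lact_continuous (a : U) : continuous (lact a : X -> X).
Proof.
apply: bounded_cont; first exact: lact_linearr.
have [M M0 XM] := bound_rnorm (lact_bounded (s := X)).
by exists (M * rnorm a) => x; exact: XM.
Qed.

Lemma ract_continuous (a : U) : continuous (ract^~ a : X -> X).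
Proof.
apply: bounded_cont; first exact: ract_linearl.
have [M M0 XM] := bound_rnorm (ract_bounded (s := X)).
by exists (M * rnorm a) => x; rewrite mulrAC; exact: XM.
Qed.

Definition lactop (a : U) : bop X X := mkbop (lact_linearr a) (@lact_continuous a).
Definition ractop (a : U) : bop X X := mkbop (ract_linearl a) (@ract_continuous a).
End dual_bimodule.

Section adjoint.
Context {R : realType}.

Lemma bop_comp_linear (X Y Z : normedModType R[i]) (g : bop Y Z) (f : bop X Y) :
  linear (g \o f).
Proof. by move=> l x y /=; rewrite !linearP. Qed.

Lemma bop_comp_cont (X Y Z : normedModType R[i]) (g : bop Y Z) (f : bop X Y) :
  continuous (g \o f).
Proof.
move=> x; apply: (@continuous_comp _ _ _ f g); exact: bop_cont.
Qed.

Definition bop_comp (X Y Z : normedModType R[i]) (g : bop Y Z) (f : bop X Y) :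
  bop X Z := mkbop (bop_comp_linear g f) (@bop_comp_cont _ _ _ g f).

Context {X Y : normedModType R[i]} (f : bop X Y).

Definition adj_fun (g : dual Y) : dual X := bop_comp g f.

Lemma adj_bound (g : dual Y) : rnorm (adj_fun g) <= opnorm f * rnorm g.
Proof.
apply: opnorm_ub => [|x]; first by rewrite mulr_ge0 ?rnorm_ge0 ?opnorm_ge0.
apply: le_trans (opnormP g (f x)) _; rewrite mulrAC [leRHS]mulrC.
by rewrite ler_wpM2l ?opnorm_ge0 ?opnormP.
Qed.

Lemma adj_linear : linear adj_fun.
Proof. by move=> l g h; apply: bop_ext. Qed.

Lemma adj_cont : continuous adj_fun.
Proof.
by apply: bounded_cont adj_linear _; exists (opnorm f) => g; exact: adj_bound.
Qed.

Definition adj : bop (dual Y) (dual X) := mkbop adj_linear adj_cont.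

Lemma adjE (g : dual Y) x : adj g x = g (f x). Proof. by []. Qed.

End adjoint.

Section dual_bimodule2.
Context {R : realType} {U : banachAlgType R} {X : banachBimodType U}.

Definition dual_lact (a : U) (f : dual X) : dual X := adj (ractop a) f.
Definition dual_ract (f : dual X) (a : U) : dual X := adj (lactop a) f.

Lemma dual_lactE a f x : dual_lact a f x = f (ract x a). Proof. by []. Qed.
Lemma dual_ractE f a x : dual_ract f a x = f (lact a x). Proof. by []. Qed.

Lemma dual_lact_linearl f : linear (dual_lact ^~ f).
Proof.
by move=> l a b; apply: bop_ext => x; rewrite dual_lactE ract_linearr linearP.
Qed.
Lemma dual_lact_linearr a : linear (dual_lact a).
Proof. by move=> l f g; apply: bop_ext. Qed.
Lemma dual_ract_linearl a : linear (dual_ract ^~ a).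
Proof. by move=> l f g; apply: bop_ext. Qed.
Lemma dual_ract_linearr f : linear (dual_ract f).
Proof.
by move=> l a b; apply: bop_ext => x; rewrite dual_ractE lact_linearl linearP.
Qed.
Lemma dual_lactA a b f : dual_lact a (dual_lact b f) = dual_lact (amul a b) f.
Proof. by apply: bop_ext => x; rewrite !dual_lactE ractA. Qed.
Lemma dual_ractA f a b : dual_ract (dual_ract f a) b = dual_ract f (amul a b).
Proof. by apply: bop_ext => x; rewrite !dual_ractE lactA. Qed.
Lemma dual_lractA a f b : dual_ract (dual_lact a f) b = dual_lact a (dual_ract f b).
Proof.
by apply: bop_ext => x; rewrite dual_ractE dual_lactE dual_lactE dual_ractE lractA.
Qed.
Lemma dual_lact_bounded : exists M : R[i], forall a f,
  `|dual_lact a f| <= M * `|a| * `|f|.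
Proof.
have [M M0 XM] := bound_rnorm (ract_bounded (s := X)).
exists M%:C => a f; rewrite !rnormE -!rmorphM lecR.
apply: le_trans (adj_bound _ _) _; rewrite ler_wpM2r ?rnorm_ge0//.
apply: opnorm_ub => [|x]; first by rewrite mulr_ge0 ?rnorm_ge0.
by rewrite mulrAC; exact: XM.
Qed.
Lemma dual_ract_bounded : exists M : R[i], forall f a,
  `|dual_ract f a| <= M * `|f| * `|a|.
Proof.
have [M M0 XM] := bound_rnorm (lact_bounded (s := X)).
exists M%:C => f a; rewrite !rnormE -!rmorphM lecR mulrAC.
apply: le_trans (adj_bound _ _) _; rewrite ler_wpM2r ?rnorm_ge0//.
apply: opnorm_ub => [|x]; first by rewrite mulr_ge0 ?rnorm_ge0.
exact: XM.
Qed.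

HB.instance Definition _ := isBanachBimodule.Build R U (dual X)
  dual_lact_linearl dual_lact_linearr dual_ract_linearl dual_ract_linearr
  dual_lactA dual_ractA dual_lractA dual_lact_bounded dual_ract_bounded.

End dual_bimodule2.

Section ptensor_bimodule.
Context {R : realType} {U : banachAlgType R}.
Notation T := (ptensor U U).

Let hT : seq_complete T := @complete_seq_complete R T.

Let lB (a : U) := fun b c : U => tens (amul a b) c.
Let rB (a : U) := fun b c : U => tens b (amul c a).

Let lB_bilinear a : bilinear_map (lB a).
Proof.
have [Tl Tr] := @tens_bilinear R U U.
split=> [w l v v'|v l w w']; rewrite /lB; last exact: Tr.
by rewrite amul_linearr Tl.
Qed.

Let rB_bilinear a : bilinear_map (rB a).
Proof.
have [Tl Tr] := @tens_bilinear R U U.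
split=> [w l v v'|v l w w']; rewrite /rB; first exact: Tl.
by rewrite amul_linearl Tr.
Qed.

Let lB_bound a b c : rnorm (lB a b c) <= rnorm a * rnorm b * rnorm c.
Proof.
by apply: le_trans (tens_norm _ _) _; rewrite ler_wpM2r ?rnorm_ge0 ?amul_rnorm.
Qed.

Let rB_bound a b c : rnorm (rB a b c) <= rnorm a * rnorm b * rnorm c.
Proof.
apply: le_trans (tens_norm _ _) _; rewrite [leRHS]mulrAC mulrC.
by rewrite ler_wpM2r ?rnorm_ge0// mulrC amul_rnorm.
Qed.

Definition pt_lact (a : U) : T -> T := plift (fun b c => tens (amul a b) c).
Definition pt_ract (t : T) (a : U) : T := plift (fun b c => tens b (amul c a)) t.

Lemma pt_lact_tens a b c : pt_lact a (tens b c) = tens (amul a b) c.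
Proof. exact: (plift_tens hT (lB_bilinear a) (rnorm_ge0 a) (lB_bound a)). Qed.
Lemma pt_ract_tens b c a : pt_ract (tens b c) a = tens b (amul c a).
Proof. exact: (plift_tens hT (rB_bilinear a) (rnorm_ge0 a) (rB_bound a)). Qed.

Lemma pt_lact_linearr a : linear (pt_lact a).
Proof. exact: (plift_linear hT (lB_bilinear a) (rnorm_ge0 a) (lB_bound a)). Qed.
Lemma pt_ract_linearl a : linear (pt_ract ^~ a).
Proof. exact: (plift_linear hT (rB_bilinear a) (rnorm_ge0 a) (rB_bound a)). Qed.

Lemma pt_lact_norm a t : rnorm (pt_lact a t) <= rnorm a * rnorm t.
Proof. exact: (plift_bounded hT (lB_bilinear a) (rnorm_ge0 a) (lB_bound a)). Qed.
Lemma pt_ract_norm a t : rnorm (pt_ract t a) <= rnorm a * rnorm t.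
Proof. exact: (plift_bounded hT (rB_bilinear a) (rnorm_ge0 a) (rB_bound a)). Qed.

Let lop (a : U) : bop T T := mkbop (pt_lact_linearr a)
  (bounded_cont (pt_lact_linearr a) (ex_intro _ _ (pt_lact_norm a))).
Let rop (a : U) : bop T T := mkbop (pt_ract_linearl a)
  (bounded_cont (pt_ract_linearl a) (ex_intro _ _ (pt_ract_norm a))).

Let ext (f g : bop T T) : (forall b c, f (tens b c) = g (tens b c)) -> f =1 g.
Proof. by move=> /ptensor_ext ->. Qed.

Lemma pt_lact_linearl t : linear (pt_lact ^~ t).
Proof.
move=> l a b; apply: (ext (f := lop (l *: a + b)) (g := l *: lop a + lop b)).
move=> c d; rewrite bopE bopZ /= !pt_lact_tens amul_linearl.
by have [+ _] := @tens_bilinear R U U; apply.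
Qed.
Lemma pt_ract_linearr t : linear (pt_ract t).
Proof.
move=> l a b; apply: (ext (f := rop (l *: a + b)) (g := l *: rop a + rop b)).
move=> c d; rewrite bopE bopZ /= !pt_ract_tens amul_linearr.
by have [_ +] := @tens_bilinear R U U; apply.
Qed.
Lemma pt_lactA a b t : pt_lact a (pt_lact b t) = pt_lact (amul a b) t.
Proof.
apply: (ext (f := bop_comp (lop a) (lop b)) (g := lop (amul a b))) => c d /=.
by rewrite !pt_lact_tens amulA.
Qed.
Lemma pt_ractA t a b : pt_ract (pt_ract t a) b = pt_ract t (amul a b).
Proof.
apply: (ext (f := bop_comp (rop b) (rop a)) (g := rop (amul a b))) => c d /=.
by rewrite !pt_ract_tens amulA.
Qed.
Lemma pt_lractA a t b : pt_ract (pt_lact a t) b = pt_lact a (pt_ract t b).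
Proof.
apply: (ext (f := bop_comp (rop b) (lop a)) (g := bop_comp (lop a) (rop b))).
by move=> c d /=; rewrite pt_lact_tens !pt_ract_tens pt_lact_tens.
Qed.
Lemma pt_lact_bounded : exists M : R[i], forall a t,
  `|pt_lact a t| <= M * `|a| * `|t|.
Proof.
by exists 1 => a t; rewrite mul1r !rnormE -rmorphM lecR pt_lact_norm.
Qed.
Lemma pt_ract_bounded : exists M : R[i], forall t a,
  `|pt_ract t a| <= M * `|t| * `|a|.
Proof.
by exists 1 => t a; rewrite mul1r !rnormE -rmorphM lecR mulrC pt_ract_norm.
Qed.

HB.instance Definition _ := isBanachBimodule.Build R U (ptensor U U)
  pt_lact_linearl pt_lact_linearr pt_ract_linearl pt_ract_linearr
  pt_lactA pt_ractA pt_lractA pt_lact_bounded pt_ract_bounded.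

Let mul_bilinear : bilinear_map (@amul R U).
Proof. by split=> [w|v]; [exact: amul_linearl|exact: amul_linearr]. Qed.

Let mul_bound (b c : U) : rnorm (amul b c) <= 1 * rnorm b * rnorm c.
Proof. by rewrite mul1r amul_rnorm. Qed.

Let hU : seq_complete U := @complete_seq_complete R U.

(* The continuous linear map with b (x) c |-> b c. *)
Definition pi_op : bop (ptensor U U) U :=
  mkbop (plift_linear hU mul_bilinear ler01 mul_bound)
        (plift_cont hU mul_bilinear ler01 mul_bound).

Lemma pi_op_tens b c : pi_op (tens b c) = amul b c.
Proof. exact: (plift_tens hU mul_bilinear ler01 mul_bound). Qed.

End ptensor_bimodule.
Arguments pi_op {R} U.

Record Delta {R : realType} (U : banachAlgType R) := Character {
  char_fun :> U -> R[i]^o ;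
  char_linear : linear char_fun ;
  charM : forall a b, char_fun (amul a b) = char_fun a * char_fun b ;
  char_neq0 : exists a, char_fun a != 0
}.

Section automatic_continuity.
Context {R : realType} {U : banachAlgType R} (phi : Delta U).

Let phiD a b : phi (a + b) = phi a + phi b.
Proof. by have := char_linear phi 1 a b; rewrite !scale1r. Qed.

Let phi0 : phi 0 = 0.
Proof. by have := char_linear phi (-1) 0 0; rewrite !scaleN1r !addNr. Qed.

Let phiZ l a : phi (l *: a) = l * phi a.
Proof. by have := char_linear phi l a 0; rewrite phi0 !addr0. Qed.

Let no_quasi_inverse (b : U) : rnorm b < 1 -> phi b <> 1.
Proof.
move=> b1 pb; pose q := rnorm b.
have q0 : 0 <= q by exact: rnorm_ge0.
pose t (x : U) := b + amul b x.
have mB x y : amul b (x - y) = amul b x - amul b y.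
  have := amul_linearr b (-1) y x; rewrite !scaleN1r.
  by rewrite (addrC x) (addrC (amul b x)).
have m0 : amul b 0 = 0 by have := mB 0 0; rewrite !subrr.
have tq x y : rnorm (t x - t y) <= q * rnorm (x - y).
  by rewrite /t opprD addrACA subrr add0r -mB amul_rnorm.
pose s n := iter n t 0.
pose K := q / (1 - q); have q1 : 0 < 1 - q by rewrite subr_gt0.
have K0 : 0 <= K by rewrite divr_ge0// ltW.
have KE : q + q * K = K.
  by rewrite /K; field; rewrite gt_eqF.
have sK k : rnorm (s k) <= K.
  elim: k => [|k IH]; first by rewrite rnorm0.
  rewrite /s iterS -/(s k) /t -KE; apply: le_trans (rnormD _ _) _.
  rewrite lerD2l; apply: le_trans (amul_rnorm _ _) _.
  by rewrite ler_wpM2l.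
have sd n k : rnorm (s (n + k)%N - s n) <= q ^+ n * K.
  elim: n => [|n IH]; first by rewrite add0n subr0 expr0 mul1r.
  rewrite addSn /s !iterS; apply: le_trans (tq _ _) _.
  by rewrite exprS -mulrA ler_wpM2l.
have small (e : R) : 0 < e -> exists N, q ^+ N * K < e.
  move=> e0; have K1 : 0 < K + 1 by rewrite ltr_wpDl.
  have /cvgrPdist_lt/(_ _ (divr_gt0 e0 K1))[N _ /(_ N (leqnn _))] : q ^+ n @[n --> \oo] --> (0 : R).
    by apply: cvg_expr; rewrite ger0_norm.
  rewrite /= sub0r normrN ger0_norm ?exprn_ge0// ltr_pdivlMr// => H.
  exists N; apply: le_lt_trans H; rewrite ler_wpM2l ?exprn_ge0// lerDl//.
have sc : rcauchy s.
  move=> e e0; have [|N NP] := small (e / 2); first by rewrite divr_gt0.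
  exists N => m n /subnKC<- /subnKC<-.
  have -> : s (N + (m - N))%N - s (N + (n - N))%N =
    (s (N + (m - N))%N - s N) - (s (N + (n - N))%N - s N).
    by rewrite opprB addrA subrK.
  apply: le_lt_trans (rnormD _ _) _; rewrite rnormN.
  have := sd N (m - N)%N; have := sd N (n - N)%N; lra.
have [c cP] := rcauchy_cvg sc.
have tc : t c = c.
  apply/eqP; rewrite -subr_eq0; apply/eqP/rnorm0_eq0/eqP.
  rewrite eq_le rnorm_ge0 andbT; apply/ler_addgt0Pr => e e0; rewrite add0r.
  have [|N NP] := cP (e / 2); first by rewrite divr_gt0.
  have H1 := NP _ (leqnn N); have H2 := NP _ (leqnSn N).
  have -> : t c - c = (t c - t (s N)) + (s N.+1 - c) by rewrite /s iterS subrKA.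
  apply: le_trans (rnormD _ _) _; have := tq c (s N); rewrite (rdistC c).
  have : q * rnorm (s N - c) <= rnorm (s N - c) by rewrite ler_piMl ?rnorm_ge0 ?ltW.
  lra.
have := congr1 phi tc; rewrite /t phiD charM pb mul1r => /eqP.
by rewrite -[X in _ == X]add0r (inj_eq (addIr _)) oner_eq0.
Qed.

Lemma char_norm (a : U) : rnorm (phi a) <= rnorm a.
Proof.
rewrite leNgt; apply/negP => ap.
have n0 : 0 < rnorm (phi a) by apply: le_lt_trans ap; exact: rnorm_ge0.
have p0 : phi a != 0 by apply: contraTneq n0 => ->; rewrite rnorm0 ltxx.
apply: (@no_quasi_inverse ((phi a)^-1 *: a)); last by rewrite phiZ mulVf.
by rewrite rnormZ Normc.normcV ltr_pdivrMl ?mulr1.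
Qed.

Lemma char_continuous : continuous phi.
Proof.
apply: bounded_cont; first exact: char_linear.
by exists 1 => a; rewrite mul1r char_norm.
Qed.

(* Characters are automatically continuous, hence define elements of the dual. *)
Definition char_dual : dual U := mkbop (char_linear phi) char_continuous.

Definition phi_tilde (F : dual (dual U)) : R[i] := F char_dual.

End automatic_continuity.

Definition johnson_amenable {R : realType} (U : banachAlgType R) (phi : Delta U) :=
  exists m : dual (dual (ptensor U U)),
    (forall a : U, lact a m = ract m a) /\
    phi_tilde phi (adj (adj (pi_op U)) m) = 1.

Section derivations.
Context {R : realType} {U : banachAlgType R} {X : banachBimodType U}.

Definition center : set X := [set x | forall a : U, lact a x = ract x a].

Definition commutator (a b : U) : U := amul a b - amul b a.
Definition bracket_ax (a : U) (x : X) : X := lact a x - ract x a.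
Definition bracket_xa (x : X) (a : U) : X := ract x a - lact a x.

Definition is_derivation (d : U -> X) :=
  forall a b, d (amul a b) = ract (d a) b + lact a (d b).

Definition is_lie_derivation (d : U -> X) := forall a b,
  d (commutator a b) = bracket_xa (d a) b + bracket_ax a (d b).

Definition is_center_valued_trace (t : U -> X) :=
  (forall a, center (t a)) /\ (forall a b, t (commutator a b) = 0).

End derivations.

(* Main.v *)
Require Import Defs.
From HB Require Import structures.
From mathcomp Require Import all_boot all_order all_algebra.
From mathcomp Require Import boolp classical_sets functions reals.
From mathcomp Require Import topology normedtype sequences.
From mathcomp Require Import complex.
From mathcomp Require Import ring lra.

Set Implicit Arguments.
Unset Strict Implicit.
Unset Printing Implicit Defensive.

Import Order.TTheory GRing.Theory Num.Theory.
Import numFieldNormedType.Exports.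

Local Open Scope classical_set_scope.
Local Open Scope ring_scope.

(* Slicing the diagonal by [phi] in either variable and multiplying the two means
   gives e in U** with a e = e a = phi(a) e and phi(e) = 1. In the case
   x.a = phi(a) x, evaluating delta on [a, e] = 0 gives
   delta(a) = (phi(a) delta(e) - a.delta(e)) + e.delta(a), an inner derivation plus
   a central term, but both with values in X**. The set S of those a for which
   e.delta(a) lies in X is a closed subspace, and it contains every
   ab - phi(b) a - phi(a) b since the corresponding defect of delta lies in X. A
   functional g vanishing on S is thus a point derivation at phi, and evaluating
   g(a e) = phi(a) g(e) in two ways yields g(a) = 0; hence S = U by Hahn-Banach.
   The other case is the same statement for the opposite multiplication. *)

(** * The real Hahn-Banach theorem *)

Section real_hahn_banach.
Context {R : realType} {V : lmodType R[i]} (p : seminorm V).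

(* Graph of a partial real-linear functional dominated by [p]; single-valuedness
   follows from the domination. *)
Definition dominated_graph (G : set (V * R)) :=
  (forall (t : R) x r y s, G (x, r) -> G (y, s) -> G (t%:C%C *: x + y, t * r + s)) /\
  (forall x r, G (x, r) -> r <= p x).

Lemma normcR (t : R) : Normc.normc t%:C%C = `|t|.
Proof. by rewrite /= expr0n/= addr0 sqrtr_sqr. Qed.

(** Subtracting the two pairs puts [(0, s - r)] and [(0, r - s)] in the graph, and [p 0 = 0]. *)
Lemma dominated_graph_fun G x r s : dominated_graph G ->
  G (x, r) -> G (x, s) -> r = s.
Proof.
have le_rs r' s' : dominated_graph G -> G (x, r') -> G (x, s') -> s' <= r'.
  move=> [Glin Gp] xr xs; have := Gp _ _ (Glin (-1) _ _ _ _ xr xs).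
  rewrite rmorphN1 scaleN1r addNr snorm0; lra.
by move=> GP xr xs; apply/eqP; rewrite eq_le !le_rs.
Qed.

(* The interval of admissible values at the new point is nonempty by the
   triangle inequality. *)
Lemma dominated_graph_step G x : dominated_graph G -> G !=set0 -> exists c : R,
  dominated_graph [set z | exists t y r,
    G (y, r) /\ z = (y + t%:C%C *: x, r + t * c)].
Proof.
move=> [Glin Gp] [[y0 r0] G0].
pose L := [set z.2 - p (z.1 - x) | z in G].
have Lub y r : G (y, r) -> ubound L (p (y + x) - r).
  move=> yr _ [[y' r'] yr' <-] /=.
  have := Gp _ _ (Glin 1 _ _ _ _ yr yr'); rewrite scale1r mul1r.
  have := snormD p (y + x) (y' - x); rewrite addrACA subrr addr0; lra.
have L0 : L !=set0 by exists (r0 - p (y0 - x)), (y0, r0).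
have Lle y r : G (y, r) -> sup L <= p (y + x) - r.
  by move=> yr; apply: ge_sup => //; exact: Lub.
have leL y r : G (y, r) -> r - p (y - x) <= sup L.
  by move=> yr; apply: ub_le_sup; [exists (p (y0 + x) - r0); exact: Lub|exists (y, r)].
have G00 : G (0, 0).
  by have := Glin (-1) _ _ _ _ G0 G0; rewrite rmorphN1 scaleN1r addNr mulN1r addNr.
have GZ t y r : G (y, r) -> G (t%:C%C *: y, t * r).
  by move=> yr; have := Glin t _ _ _ _ yr G00; rewrite !addr0.
have pZ (t : R) y : 0 <= t -> p (t%:C%C *: y) = t * p y.
  by move=> t0; rewrite snormZ normcR ger0_norm.
exists (sup L); split.
  move=> t _ _ _ _ [a [y [r [yr [-> ->]]]]] [b [y' [r' [yr' [-> ->]]]]].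
  exists (t * a + b), (t%:C%C *: y + y'), (t * r + r'); split; first exact: Glin.
  congr (_, _); last by ring.
  by rewrite rmorphD rmorphM scalerDl scalerDr scalerA addrACA.
move=> _ _ [t [y [r [yr [-> ->]]]]].
(* Factoring out [|t|] leaves the cases [t = -1] and [t = 1], which are the two bounds [leL] and
   [Lle] on [sup L]. *)
have [t0|t0|->] := ltgtP t 0; last by rewrite scale0r mul0r !addr0 Gp.
  have := leL _ _ (GZ (- t)^-1 _ _ yr); rewrite -subr_ge0.
  have nt0 : 0 < - t by rewrite oppr_gt0.
  rewrite -(pmulr_rge0 _ nt0) => H.
  have -> : y + t%:C%C *: x = (- t)%:C%C *: ((- t)^-1%:C%C *: y - x).
    by rewrite scalerBr scalerA -rmorphM divff ?gt_eqF// scale1r rmorphN scaleNr opprK.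
  rewrite pZ; last exact: ltW.
  move: H; rewrite !mulrBr mulrA divff ?gt_eqF//; lra.
have := Lle _ _ (GZ t^-1 _ _ yr); rewrite -subr_ge0 -(pmulr_rge0 _ t0) => H.
have -> : y + t%:C%C *: x = t%:C%C *: (t^-1%:C%C *: y + x).
  by rewrite scalerDr scalerA -rmorphM divff ?gt_eqF// scale1r.
rewrite pZ; last exact: ltW.
  move: H; rewrite !mulrBr mulrA divff ?gt_eqF//; lra.
Qed.

(** Zorn's lemma runs over the sets whose union with [G0] is dominated, so the empty chain needs no
    separate case. By the one-step extension a maximal graph is defined everywhere. *)
Lemma hahn_banach_real G0 : dominated_graph G0 -> G0 !=set0 ->
  exists u : V -> R, [/\ forall t x y, u (t%:C%C *: x + y) = t * u x + u y,
    forall x, u x <= p x & forall x r, G0 (x, r) -> u x = r].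
Proof.
move=> G0d [[x0 r0] xr0].
have [|G [Gd Gmax]] := @Zorn_bigcup _ [set G | dominated_graph (G0 `|` G)].
  move=> F FP Ftot.
  (* Domination constrains at most two points at a time, and in a chain two points share a
     member. *)
  have step z w : (G0 `|` \bigcup_(X in F) X) z -> (G0 `|` \bigcup_(X in F) X) w ->
      exists G, [/\ dominated_graph G, G z, G w &
        G `<=` G0 `|` \bigcup_(X in F) X].
    have sub X : F X -> G0 `|` X `<=` G0 `|` \bigcup_(X in F) X.
      by move=> FX; apply: setUS; exact: bigcup_sup.
    move=> [z0|[X FX Xz]] [w0|[Y FY Yw]].
    - by exists G0; split=> //; exact: subsetUl.
    - by exists (G0 `|` Y); split; [exact: FP|left|right|exact: sub].
    - by exists (G0 `|` X); split; [exact: FP|right|left|exact: sub].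
    have [XY|YX] := Ftot _ _ FX FY.
      by exists (G0 `|` Y); split; [exact: FP|right; exact: XY|right|exact: sub].
    by exists (G0 `|` X); split; [exact: FP|right|right; exact: YX|exact: sub].
  split=> [t x r y s xr ys|x r xr].
    by have [G [[+ _] Gx Gy +]] := step _ _ xr ys; move=> Gl; apply; exact: Gl.
  by have [G [[_ +] Gx _ _]] := step _ _ xr xr; apply.
set H := G0 `|` G in Gd.
have H0 : H !=set0 by exists (x0, r0); left.
have /choice[u uP] x : exists r, H (x, r).
  apply: contrapT => nx; have [c] := dominated_graph_step x Gd H0.
  set H' := (X in dominated_graph X) => H'd.
  have HH' : H `<=` H'.
    by move=> [y r] yr; exists 0, y, r; rewrite scale0r mul0r !addr0.
  have H00 : H (0, 0).
    have [Hl _] := Gd; have xr0' : H (x0, r0) by left.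
    by have := Hl (-1) _ _ _ _ xr0' xr0'; rewrite rmorphN1 scaleN1r addNr mulN1r addNr.
  apply: (Gmax H').
    split; first by apply: subset_trans HH'; exact: subsetUr.
    move=> H'G; apply: nx; exists c; right; apply: H'G.
    by exists 1, 0, 0; rewrite scale1r !add0r mul1r.
  rewrite /mkset (_ : G0 `|` H' = H')//; apply/setUidPr.
  by apply: subset_trans HH'; exact: subsetUl.
have [Hl Hp] := Gd.
exists u; split=> [t x y|x|x r xr]; last 2 first.
- exact: Hp (uP x).
- by apply: (dominated_graph_fun Gd (uP x)); left.
by apply: (dominated_graph_fun Gd (uP _)); exact: Hl (uP x) (uP y).
Qed.

End real_hahn_banach.

(** * Complex Hahn-Banach: separation from a subspace, norming functionals *)

Section hahn_banach.
Context {R : realType} {V : normedModType R[i]}.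

Definition rnorm_seminorm (K : R) (K0 : 0 <= K) : seminorm V.
Proof.
apply: (@Seminorm R V (fun x => K * rnorm x)) => [u v|l u].
  by rewrite -mulrDr ler_wpM2l ?rnormD.
by rewrite rnormZ mulrCA.
Defined.

Lemma normc_conjM (c : R[i]) : c^*%C * c = (Normc.normc c ^+ 2)%:C%C.
Proof.
case: c => a b /=; rewrite sqr_sqrtr ?addr_ge0 ?sqr_ge0//.
by apply/eqP; rewrite eq_complex/=; apply/andP; split; apply/eqP; ring.
Qed.

(** On [S + C x] the map [s + l x |-> l] is bounded by [r^-1], as factoring out [l] shows. Its real
    part is extended by the real theorem and then complexified. *)
Lemma hahn_banach_separation (S : {pred V}) x (r : R) : submod_closed S -> 0 < r ->
  (forall s, s \in S -> r <= rnorm (x - s)) ->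
  exists f : dual V, [/\ forall s, s \in S -> f s = 0, f x = 1 &
    forall z, rnorm (f z) <= r^-1 * rnorm z].
Proof.
move=> [S0 Slin] r0 Sx; have r'0 : 0 <= r^-1 by rewrite invr_ge0 ltW.
have SZ l s : s \in S -> l *: s \in S.
  by move=> sS; rewrite -[_ *: _]addr0 Slin.
pose p := rnorm_seminorm r'0.
pose G : set (V * R) := [set z | exists s (l : R[i]),
  s \in S /\ z = (s + l *: x, complex.Re l)].
have rl s l : s \in S -> Normc.normc l <= p (s + l *: x).
  move=> sS; rewrite /p/= ler_pdivlMl// mulrC.
  have [->|l0] := eqVneq l 0; first by rewrite Normc.normc0 mul0r rnorm_ge0.
  have -> : s + l *: x = l *: (x - (- l^-1) *: s).
    by rewrite scalerBr scalerA mulrN mulfV// scaleN1r opprK addrC.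
  by rewrite rnormZ ler_wpM2l ?normc_ge0// Sx// SZ.
have Re_le (c : R[i]) : complex.Re c <= Normc.normc c.
  case: c => a b /=; apply: le_trans (ler_norm _) _.
  by rewrite -sqrtr_sqr ler_wsqrtr// lerDl sqr_ge0.
have Gd : dominated_graph p G.
  split=> [t _ _ _ _ [s [l [sS [-> ->]]]] [s' [l' [s'S [-> ->]]]]|].
    exists (t%:C%C *: s + s'), (t%:C%C * l + l'); split; first exact: Slin.
    congr (_, _); last by case: l l' => [a b] [a' b'] /=; ring.
    by rewrite scalerDl scalerDr scalerA addrACA.
  by move=> _ _ [s [l [sS [-> ->]]]]; apply: le_trans (Re_le _) (rl _ _ _).
have G0 : G !=set0 by exists (0, 0), 0, 0; rewrite scale0r addr0.
have [u [ulin up uG]] := hahn_banach_real Gd G0.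
have uD y z : u (y + z) = u y + u z by have := ulin 1 y z; rewrite scale1r mul1r.
have u0 : u 0 = 0 by have := uD 0 0; rewrite addr0 => /eqP; lra.
have uZ t z : u (t%:C%C *: z) = t * u z by have := ulin t z 0; rewrite u0 !addr0.
(* The only complex-linear map with real part [u]. *)
pose f (z : V) : R[i]^o := Complex (u z) (- u ('i%C *: z)).
have uc (a b : R) z : u ((a +i* b)%C *: z) = a * u z + b * u ('i%C *: z).
  by rewrite -!uZ -uD scalerA -scalerDl; congr (u (_ *: _)); simpc.
have flin : linear f.
  move=> [a b] y z; apply/eqP; rewrite eq_complex /=; apply/andP; split; apply/eqP.
    by rewrite uD uc; ring.
  rewrite scalerDr scalerA uD (_ : 'i%C * (a +i* b)%C = ((- b) +i* a)%C); last by simpc.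
  by rewrite uc; ring.
have fp z : rnorm (f z) <= r^-1 * rnorm z.
  have nE : rnorm (f z) = Normc.normc (f z) by [].
  have [n0|n0] := eqVneq (rnorm (f z)) 0.
    by rewrite n0 mulr_ge0 ?rnorm_ge0.
  have nfz : 0 < rnorm (f z) by rewrite lt_def n0 rnorm_ge0.
  (* Multiplying [z] by the conjugate of [f z] makes the value of [f] real, so the bound on [u]
     gives the same bound on [|f|]. *)
  have fw : f ((f z)^*%C *: z) = (rnorm (f z) ^+ 2)%:C%C.
    have := flin (f z)^*%C z 0; rewrite addr0 (_ : f 0 = 0); last first.
      by rewrite /f scaler0 u0 oppr0.
    by rewrite addr0 => ->; rewrite nE -normc_conjM.
  have := up ((f z)^*%C *: z).
  rewrite -[u _]/(complex.Re (f ((f z)^*%C *: z))) fw /= rnormZ.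
  have -> : Normc.normc (f z)^*%C = rnorm (f z) by rewrite nE; case: (f z) => a b /=; rewrite sqrrN.
  by rewrite mulrCA expr2 ler_pM2l.
exists (mkbop flin (bounded_cont flin (ex_intro _ _ fp))); split=> // [s sS|] /=.
  have uS s' : s' \in S -> u s' = 0.
    by move=> s'S; apply: uG; exists s', 0; rewrite scale0r addr0.
  by rewrite /f !uS ?SZ// oppr0.
rewrite /f (uG x 1); last by exists 0, 1; rewrite scale1r add0r.
rewrite (uG _ 0) ?oppr0//.
by exists 0, 'i%C; rewrite add0r.
Qed.

(** Separation from the zero subspace at distance [rnorm x], rescaled. *)
Lemma dual_norming (x : V) : x != 0 ->
  exists2 f : dual V, f x = (rnorm x)%:C%C & rnorm f <= 1.
Proof.
move=> x0; have nx0 : 0 < rnorm x.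
  by rewrite lt_def rnorm_ge0 andbT; apply: contra_neq x0; exact: rnorm0_eq0.
have [] := @hahn_banach_separation (pred1 0) x _ _ nx0.
- split=> [|l y z]; rewrite !inE// => /eqP-> /eqP->.
  by rewrite scaler0 addr0.
- by move=> s; rewrite inE => /eqP->; rewrite subr0.
move=> f [_ fx fp]; exists ((rnorm x)%:C%C *: f); first by rewrite bopZ fx; exact: mulr1.
have fn : opnorm f <= (rnorm x)^-1 by apply: opnorm_ub; rewrite ?invr_ge0 ?rnorm_ge0.
rewrite rnormZ normcR ger0_norm ?rnorm_ge0//.
by rewrite -(mulfV (x := rnorm x)) ?gt_eqF// ler_wpM2l ?rnorm_ge0.
Qed.

End hahn_banach.

(** Linearity with the product of [R[i]] in place of its scaling, as [ring] expects. *)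
Lemma dual_linear {R : realType} {V : normedModType R[i]} (f : dual V) l x y :
  f (l *: x + y) = l * f x + f y.
Proof. exact: linearP. Qed.

Lemma dualD {R : realType} {V : normedModType R[i]} (f : dual V) x y :
  f (x + y) = f x + f y.
Proof. exact: linearD. Qed.

Lemma dualB {R : realType} {V : normedModType R[i]} (f : dual V) x y :
  f (x - y) = f x - f y.
Proof. exact: linearB. Qed.

Lemma dualZ {R : realType} {V : normedModType R[i]} (f : dual V) l x :
  f (l *: x) = l * f x.
Proof. exact: linearZ. Qed.

(** * Product functionals on the projective tensor product *)

Section tensor_functional.
Context {R : realType} {V W : normedModType R[i]} (g : dual V) (h : dual W).

Let B x y : R[i]^o := g x * h y.

Let bB : bilinear_map B.
Proof.
by split=> [y|x] l u v; rewrite /B dual_linear -[l *: _]/(l * _); ring.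
Qed.

Let BM x y : rnorm (B x y) <= rnorm g * rnorm h * rnorm x * rnorm y.
Proof.
have -> : rnorm (B x y) = rnorm (g x) * rnorm (h y) by exact: rnormZ.
apply: le_trans (ler_pM _ _ (opnormP g x) (opnormP h y)) _; rewrite ?rnorm_ge0//.
by rewrite mulrACA mulrA.
Qed.

Let M0 : 0 <= rnorm g * rnorm h. Proof. by rewrite mulr_ge0 ?rnorm_ge0. Qed.

Let hC : seq_complete R[i]^o := @complex_rcauchy R.

Definition tens_functional : dual (ptensor V W) :=
  mkbop (plift_linear hC bB M0 BM) (plift_cont hC bB M0 BM).

Lemma tens_functionalE x y : tens_functional (tens x y) = g x * h y.
Proof. exact: (plift_tens hC bB M0 BM). Qed.

Lemma tens_functional_norm : rnorm tens_functional <= rnorm g * rnorm h.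
Proof. by apply: opnorm_ub => // u; exact: (plift_bounded hC bB M0 BM). Qed.

End tensor_functional.

Section tens_functional_op.
Context {R : realType} {V W : normedModType R[i]}.

Lemma tens_functional_linearl (h : dual W) :
  linear (fun g : dual V => tens_functional g h).
Proof.
move=> l g g'; apply: ptensor_ext => x y.
by rewrite bopE bopZ !tens_functionalE bopE bopZ -![l *: _]/(l * _); ring.
Qed.

Lemma tens_functional_linearr (g : dual V) :
  linear (fun h : dual W => tens_functional g h).
Proof.
move=> l h h'; apply: ptensor_ext => x y.
by rewrite bopE bopZ !tens_functionalE bopE bopZ -![l *: _]/(l * _); ring.
Qed.

Let tens_functional_norml (h : dual W) (g : dual V) :
  rnorm (tens_functional g h) <= rnorm h * rnorm g.
Proof. by rewrite mulrC tens_functional_norm. Qed.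

(** Composing an element of the bidual of [ptensor V W] with this map slices it by [h] in the second
    variable; [tens_opr] does so in the first. *)
Definition tens_opl (h : dual W) : bop (dual V) (dual (ptensor V W)) :=
  mkbop (tens_functional_linearl h) (bounded_cont (tens_functional_linearl h)
    (ex_intro _ _ (tens_functional_norml h))).

Definition tens_opr (g : dual V) : bop (dual W) (dual (ptensor V W)) :=
  mkbop (tens_functional_linearr g) (bounded_cont (tens_functional_linearr g)
    (ex_intro _ _ (tens_functional_norm g))).

End tens_functional_op.

(** * A two-sided [phi]-invariant mean *)

Section invariant_mean.
Context {R : realType} {U : banachAlgType R} (phi : Delta U).

Let phi' : dual U := char_dual phi.

Lemma amulr_continuous (a : U) : continuous (amul a).
Proof.
by apply: bounded_cont; [exact: amul_linearr|exists (rnorm a) => b; exact: amul_rnorm].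
Qed.

Definition mulop (a : U) : bop U U := mkbop (amul_linearr a) (@amulr_continuous a).

Section translate.
Variables (n : dual (dual U)) (g : dual U).

(** This is [n . g], from which the first Arens product on the bidual is formed: [m n] sends [g] to
    [m (n . g)]. *)
Let ng (x : U) : R[i]^o := n (bop_comp g (mulop x)).

Let ng_linear : linear ng.
Proof.
move=> l x y; rewrite /ng.
have -> : bop_comp g (mulop (l *: x + y)) =
    l *: (bop_comp g (mulop x) : dual U) + (bop_comp g (mulop y) : dual U).
  by apply: bop_ext => z; rewrite bopE bopZ /= amul_linearl dual_linear.
exact: linearP.
Qed.

Let ng_bound x : rnorm (ng x) <= rnorm n * rnorm g * rnorm x.
Proof.
apply: le_trans (opnormP n _) _; rewrite -mulrA ler_wpM2l ?opnorm_ge0//.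
apply: opnorm_ub => [|z]; first by rewrite mulr_ge0 ?rnorm_ge0.
apply: le_trans (opnormP g _) _; rewrite -mulrA ler_wpM2l ?opnorm_ge0//.
exact: amul_rnorm.
Qed.

Definition arens : dual U :=
  mkbop ng_linear (bounded_cont ng_linear (ex_intro _ _ ng_bound)).

Lemma arensE x : arens x = n (bop_comp g (mulop x)). Proof. by []. Qed.

Lemma arens_norm : rnorm arens <= rnorm n * rnorm g.
Proof. by apply: opnorm_ub => [|x]; [rewrite mulr_ge0 ?rnorm_ge0|exact: ng_bound]. Qed.

End translate.

Lemma arens_linear n : linear (arens n).
Proof.
move=> l g h; apply: bop_ext => x; rewrite bopE bopZ !arensE -linearP.
by congr (n _); apply: bop_ext.
Qed.

Definition arens_op n : bop (dual U) (dual U) := mkbop (@arens_linear n)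
  (bounded_cont (@arens_linear n) (ex_intro _ _ (arens_norm n))).

Hypothesis U_amenable : johnson_amenable phi.

(* Slicing the diagonal [m] by [phi] in one of the two variables gives a mean
   invariant on one side; the Arens product of the two is invariant on both. *)
Lemma johnson_amenable_mean : exists e : dual (dual U), [/\ e phi' = 1,
  forall a (g h : dual U), (forall x, h x = g (amul a x)) -> e h = phi a * e g &
  forall a (g h : dual U), (forall x, h x = g (amul x a)) -> e h = phi a * e g].
Proof.
have [m [am m1]] := U_amenable.
(* The identity [m . a = a . m] evaluated at [F], in a form checked on elementary tensors only. *)
have mE a (F : dual (ptensor U U)) (G : dual (ptensor U U)) (H : dual (ptensor U U)) :
    (forall b c, G (tens b c) = F (tens (amul a b) c)) ->
    (forall b c, H (tens b c) = F (tens b (amul c a))) -> m G = m H.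
  move=> GP HP; have -> : G = dual_ract F a.
    by apply: ptensor_ext => b c; rewrite GP -pt_lact_tens.
  have -> : H = dual_lact a F.
    by apply: ptensor_ext => b c; rewrite HP -pt_ract_tens.
  exact: (congr1 (fun k : dual (dual (ptensor U U)) => k F) (am a)).
have phiM a b : phi' (amul a b) = phi' a * phi' b by exact: charM.
(* As [phi] is multiplicative, its composite with the product map is the product functional of [phi]
   with itself. *)
have m1' : m (tens_functional phi' phi') = 1.
  rewrite -m1; congr (m _); apply: ptensor_ext => b c.
  by rewrite tens_functionalE -phiM -pi_op_tens.
pose n : dual (dual U) := bop_comp m (tens_opl phi').
pose n' : dual (dual U) := bop_comp m (tens_opr phi').
(* The diagonal carries [a] from the first variable to the second, where [phi] turns it into a
   scalar; [n'P] uses the reverse move. *)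
have nP a (g h : dual U) : (forall x, h x = g (amul a x)) -> n h = phi a * n g.
  move=> gh; rewrite -dualZ /=; apply: (mE a (tens_functional g phi')) => b c.
    by rewrite !tens_functionalE gh.
  by rewrite !tens_functionalE bopZ phiM -[phi a *: _]/(phi a * _) -[phi' a]/(phi a); ring.
have n'P a (g h : dual U) : (forall x, h x = g (amul x a)) -> n' h = phi a * n' g.
  move=> gh; rewrite -dualZ /=; apply/esym/(mE a (tens_functional phi' g)) => b c.
    by rewrite !tens_functionalE bopZ phiM -[phi a *: _]/(phi a * _) -[phi' a]/(phi a); ring.
  by rewrite !tens_functionalE gh.
pose e : dual (dual U) := bop_comp n (arens_op n').
have eE g : e g = n (arens n' g) by [].
exists e; split=> [|a g h gh|a g h gh]; rewrite !eE.
- have -> : arens n' phi' = phi'; last exact: m1'.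
  apply: bop_ext => x; rewrite arensE.
  have -> : bop_comp phi' (mulop x) = phi' x *: (phi' : dual U).
    by apply: bop_ext => y; rewrite bopZ; exact: phiM.
  by rewrite dualZ [n' _]m1' mulr1.
(* By associativity, left translation of [g] passes to [arens n' g], where [n] absorbs it; right
   translation is absorbed by [n'] first. *)
- apply: nP => x; rewrite !arensE; congr (n' _); apply: bop_ext => y /=.
  by rewrite gh amulA.
- rewrite -dualZ; congr (n _); apply: bop_ext => x; rewrite bopZ !arensE.
  by apply: n'P => y /=; rewrite gh amulA.
Qed.

End invariant_mean.

Lemma dual_separates {R : realType} {V : normedModType R[i]} (x y : V) :
  (forall f : dual V, f x = f y) -> x = y.
Proof.
move=> xy; apply/eqP; rewrite -subr_eq0; apply: contraT => xy0.
have [f fxy _] := dual_norming xy0; move: fxy; rewrite dualB xy subrr.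
by move=> /esym/complexI/rnorm0_eq0/eqP; rewrite (negbTE xy0).
Qed.

(** * Lie derivations when one action is by a character *)

Section character_action.
Context {R : realType} {U : normedModType R[i]} {X : completeNormedModType R[i]}.
Variables (mul : U -> U -> U) (act : U -> X -> X) (phi : dual U).
Variables (e : dual (dual U)) (delta : bop U X).
Hypothesis act_linearl : forall x, linear (act ^~ x).
Hypothesis act_linearr : forall a, linear (act a).
Variable M : R.
Hypothesis M0 : 0 <= M.
Hypothesis act_bound : forall a x, rnorm (act a x) <= M * rnorm a * rnorm x.
Hypothesis actA : forall a b x, act a (act b x) = act (mul a b) x.
Hypothesis phiM : forall a b, phi (mul a b) = phi a * phi b.
Hypothesis e_phi : e phi = 1.
Hypothesis e_left : forall a (g h : dual U),
  (forall x, h x = g (mul a x)) -> e h = phi a * e g.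
Hypothesis e_commutator : forall a (g h : dual U),
  (forall x, h x = g (mul a x - mul x a)) -> e h = 0.
Hypothesis delta_lie : forall a b, delta (mul a b - mul b a) =
  (act a (delta b) - phi a *: delta b) - (act b (delta a) - phi b *: delta a).

Let actlop (a : U) : bop X X := mkbop (act_linearr a)
  (bounded_cont (act_linearr a) (ex_intro _ _ (act_bound a))).

Let act_bound' x a : rnorm (act a x) <= M * rnorm x * rnorm a.
Proof. by rewrite mulrAC act_bound. Qed.

Let actrop (x : X) : bop U X := mkbop (act_linearl x)
  (bounded_cont (act_linearl x) (ex_intro _ _ (act_bound' x))).

(* [tau a] is [e . delta a] as an element of the bidual of [X]. *)
Let tau (a : U) (f : dual X) : R[i] := e (bop_comp f (actrop (delta a))).

Let tau_linear f l a b : tau (l *: a + b) f = l * tau a f + tau b f.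
Proof.
rewrite /tau -dual_linear; congr (e _); apply: bop_ext => x.
by rewrite bopE bopZ /= linearP act_linearr dual_linear.
Qed.

Let tau0 f : tau 0 f = 0.
Proof. by have := tau_linear f (-1) 0 0; rewrite scaler0 addr0 mulN1r addNr. Qed.

Let tauZ l a f : tau (l *: a) f = l * tau a f.
Proof. by rewrite -[l *: a]addr0 tau_linear tau0 addr0. Qed.

Let tauB a b f : tau (a - b) f = tau a f - tau b f.
Proof. by rewrite addrC -scaleN1r tau_linear; ring. Qed.

Let C := opnorm e * M * opnorm delta.

Let C0 : 0 <= C. Proof. by rewrite !mulr_ge0 ?opnorm_ge0. Qed.

Let tau_bound a f : Normc.normc (tau a f) <= C * rnorm a * rnorm f.
Proof.
apply: le_trans (opnormP e _) _; rewrite /C -!mulrA ler_wpM2l ?opnorm_ge0//.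
apply: opnorm_ub => [|x]; first by rewrite !mulr_ge0 ?rnorm_ge0 ?opnorm_ge0.
apply: le_trans (opnormP f _) _.
have -> : M * (opnorm delta * (rnorm a * rnorm f)) * rnorm x =
  rnorm f * (M * rnorm x * (opnorm delta * rnorm a)) by ring.
rewrite ler_wpM2l ?opnorm_ge0//; apply: le_trans (act_bound _ _) _.
by rewrite ler_wpM2l ?opnormP// mulr_ge0 ?rnorm_ge0.
Qed.

(* [delta - tau] is the inner derivation induced by [- delta e]. *)
Let tau_inner a f : tau a f = f (delta a) +
  e (bop_comp f (bop_comp (actlop a) delta)) - phi a * e (bop_comp f delta).
Proof.
pose h : dual U := (bop_comp f (bop_comp (actlop a) delta) : dual U)
  - phi a *: (bop_comp f delta : dual U).
pose h' : dual U := (bop_comp f (actrop (delta a)) : dual U) - f (delta a) *: phi.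
have : e (h - h') = 0.
  apply: (@e_commutator a (bop_comp f delta)) => x.
  rewrite -[LHS]/((f (act a (delta x)) - phi a * f (delta x)) -
    (f (act x (delta a)) - f (delta a) * phi x)).
  by rewrite -[RHS]/(f (delta _)) delta_lie !dualB !dualZ [phi x * _]mulrC.
rewrite dualB /h /h' !dualB !dualZ e_phi mulr1 -/(tau a f).
by move=> /eqP; rewrite subr_eq0 => /eqP E; rewrite -addrA E; ring.
Qed.

(** Left invariance of [e]: [b . (e . delta a) = (b e) . delta a]. *)
Let tau_central a b f : tau a (bop_comp f (actlop b)) = phi b * tau a f.
Proof. by apply: e_left => x /=; rewrite actA. Qed.

(** Since [tau - delta] is inner, [tau] and [delta] have the same defect from being a derivation,
    and [tau_central] turns [a . tau b] into [phi a * tau b]. The common defect lies in [X]. *)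
Let tauM a b f : tau (mul a b) f - phi b * tau a f - phi a * tau b f =
  f (delta (mul a b) - phi b *: delta a - act a (delta b)).
Proof.
rewrite -(tau_central b a) !tau_inner phiM !dualB !dualZ.
rewrite -[_ (act a (delta b))]/(f (act a (delta b))).
set E1 := e (bop_comp f (bop_comp (actlop (mul a b)) delta)).
have -> : e (bop_comp (bop_comp f (actlop a)) (bop_comp (actlop b) delta)) = E1.
  by congr (e _); apply: bop_ext => x /=; rewrite actA.
have -> : bop_comp (bop_comp f (actlop a)) delta =
    bop_comp f (bop_comp (actlop a) delta) by apply: bop_ext.
by rewrite /=; ring.
Qed.

Let represents y a := forall f : dual X, f y = tau a f.

(** A norming functional of [y] transfers the bound on [tau]; it makes representatives of a Cauchy
    sequence Cauchy. *)
Let represents_norm y a : represents y a -> rnorm y <= C * rnorm a.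
Proof.
move=> ya; have [->|y0] := eqVneq y 0; first by rewrite rnorm0 mulr_ge0 ?rnorm_ge0.
have [f fy f1] := dual_norming y0.
have := tau_bound a f; rewrite -ya fy normcR ger0_norm ?rnorm_ge0// => /le_trans; apply.
by rewrite ler_piMr// mulr_ge0 ?rnorm_ge0.
Qed.

Let representsB y a z b : represents y a -> represents z b ->
  represents (y - z) (a - b).
Proof. by move=> ya zb f; rewrite dualB ya zb tauB. Qed.

Let S : {pred U} := fun a => `[< exists y, represents y a >].

Let S_submod : submod_closed S.
Proof.
split; first by apply/asboolP; exists 0 => f; rewrite tau0 linear0.
move=> l a b /asboolP[y ya] /asboolP[z zb]; apply/asboolP; exists (l *: y + z) => f.
by rewrite dual_linear ya zb tau_linear.
Qed.

(** As [X] is complete, the representatives of a sequence tending to [a] converge, and their limit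
    represents [a]. *)
Let S_closed a : (forall r : R, 0 < r -> exists2 s, s \in S & rnorm (a - s) < r) ->
  a \in S.
Proof.
move=> aS.
have /choice[s sP] (n : nat) : exists s, s \in S /\ rnorm (a - s) < n.+1%:R^-1.
  by have [|s sS sa] := aS n.+1%:R^-1; [rewrite invr_gt0|exists s].
have /choice[y yP] n : exists y, represents y (s n).
  by have [/asboolP] := sP n.
(* [C] may be zero, so [C + 1] serves as divisor. *)
have C1 : 0 < C + 1 by rewrite ltr_wpDl.
have small (r : R) : 0 < r -> exists N, forall n, (N <= n)%N ->
    rnorm (a - s n) < r / (C + 1).
  move=> r0; have /cvgrPdist_lt/(_ _ (divr_gt0 r0 C1))[N _ NP] := @cvg_harmonic R.
  exists N => n /NP/=; rewrite sub0r normrN ger0_norm ?invr_ge0//.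
  by apply: lt_trans; have [] := sP n.
have smallC (r d : R) : 0 <= d -> d < r / (C + 1) -> C * d < r.
  move=> d0; rewrite ltr_pdivlMr// => /(le_lt_trans _); apply.
  by rewrite mulrC ler_wpM2l// lerDl.
have yc : rcauchy y.
  move=> r r0; have r20 : 0 < r / 2 by rewrite divr_gt0.
  have [N NP] := small _ r20; exists N => m n /NP mN /NP nN.
  apply: le_lt_trans (represents_norm (representsB (yP m) (yP n))) _.
  have -> : s m - s n = (a - s n) - (a - s m) by rewrite opprB [RHS]addrC subrKA.
  have H := rnormD (a - s n) (- (a - s m)); rewrite rnormN in H.
  have H1 := smallC _ _ (rnorm_ge0 _) mN; have H2 := smallC _ _ (rnorm_ge0 _) nN.
  by have := ler_wpM2l C0 H; rewrite mulrDr; lra.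
have [z yz] := rcauchy_cvg yc; apply/asboolP; exists z => f.
apply/eqP; rewrite -subr_eq0; apply/eqP/Normc.eq0_normc/eqP.
rewrite eq_le normc_ge0 andbT; apply/ler_addgt0Pr => r r0; rewrite add0r.
have f1 : 0 < rnorm f + 1 by rewrite ltr_wpDl ?rnorm_ge0.
have r20 : 0 < r / (rnorm f + 1) / 2 by rewrite !divr_gt0.
have [N /(_ _ (leq_maxl _ _)) NP] := small _ r20.
have [N' /(_ _ (leq_maxr _ _)) N'P] := yz _ r20.
have := NP N'; have := N'P N; set k := maxn _ _ => yk ak.
have -> : f z - tau a f = - (f (y k - z) + tau (a - s k) f).
  by rewrite dualB tauB yP; ring.
rewrite normcN; apply: le_trans (le_normcD _ _) _.
have H1 := opnormP f (y k - z); have H2 := tau_bound (a - s k) f.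
have {}ak := smallC _ _ (rnorm_ge0 _) ak.
have H3 : rnorm f * rnorm (y k - z) <= rnorm f * (r / (rnorm f + 1) / 2).
  by rewrite ler_wpM2l ?rnorm_ge0 ?ltW.
have H4 : C * rnorm (a - s k) * rnorm f <= r / (rnorm f + 1) / 2 * rnorm f.
  by rewrite ler_wpM2r ?rnorm_ge0 ?ltW.
have H5 : rnorm f * (r / (rnorm f + 1)) <= r.
  by rewrite mulrCA ler_piMr ?ltW// ltr_pdivrMr// mul1r ltrDl.
apply: le_trans (lerD H1 H2) _; rewrite -[opnorm f]/(rnorm f).
apply: le_trans (lerD H3 H4) _; apply: le_trans H5; lra.
Qed.

Let SM a b : mul a b - phi b *: a - phi a *: b \in S.
Proof.
apply/asboolP; exists (delta (mul a b) - phi b *: delta a - act a (delta b)) => f.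
by rewrite -tauM !tauB !tauZ.
Qed.

(* A functional vanishing on [S] is a point derivation at [phi], and the mean
   [e] rules out nonzero point derivations. *)
Let S_full a : a \in S.
Proof.
apply: S_closed => r r0; apply: contrapT => nS.
have [|g [gS ga _]] := hahn_banach_separation S_submod r0 (x := a).
  by move=> s sS; rewrite leNgt; apply/negP => as_; apply: nS; exists s.
have gM b c : g (mul b c) = phi c * g b + phi b * g c.
  have := gS _ (SM b c); rewrite !dualB !dualZ => /eqP.
  by rewrite -addrA -opprD subr_eq0 => /eqP.
suff : g a = 0 by rewrite ga => /eqP; rewrite oner_eq0.
(* By [gM] this functional is [x |-> g (a x)], so invariance gives
   [g a + phi a * e g = phi a * e g]. *)
have := @e_left a g (g a *: phi + phi a *: g); rewrite dualD !dualZ e_phi mulr1.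
move=> /(_ _)/eqP; rewrite -[X in _ == X]add0r (inj_eq (addIr _)) => H.
by apply/eqP/H => x; rewrite gM mulrC.
Qed.

(** The trace [t a] is the element of [X] representing [tau a], and [d] is [delta - t]. Keeping
    [mul] and [act] abstract lets the opposite multiplication be substituted. *)
Lemma lie_derivation_character_action : exists d t : bop U X,
  [/\ forall a b, d (mul a b) = phi b *: d a + act a (d b),
      forall a b, act b (t a) = phi b *: t a,
      forall a b, t (mul a b) = t (mul b a) &
      forall a, delta a = d a + t a].
Proof.
have /choice[t tP] a : exists y, represents y a by exact/asboolP/S_full.
(* Functionals separate points, so identities for [tau] pass to [t]. *)
have tlin : linear t.
  by move=> l a b; apply: dual_separates => f; rewrite dual_linear !tP tau_linear.
have tb a : rnorm (t a) <= C * rnorm a by exact: represents_norm.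
pose t' := mkbop tlin (bounded_cont tlin (ex_intro _ _ tb)).
have tcentral a b : act b (t a) = phi b *: t a.
  by apply: dual_separates => f; rewrite dualZ tP -tau_central -tP.
have tM a b : t (mul a b) - phi b *: t a - phi a *: t b =
    delta (mul a b) - phi b *: delta a - act a (delta b).
  by apply: dual_separates => f; rewrite -tauM !dualB !dualZ !tP.
have tE a b : t (mul a b) = delta (mul a b) - phi b *: delta a -
    act a (delta b) + phi a *: t b + phi b *: t a by rewrite -tM !subrK.
have actB a x y : act a (x - y) = act a x - act a y.
  by have := linearB (actlop a) x y.
have d'E a : (delta - t') a = delta a - t a by [].
exists (delta - t'), t'; split=> // [a b|a b|a].
- rewrite !d'E actB tcentral scalerBr tE !opprD !opprK !addrA subrr add0r.
  by rewrite [LHS](ACl (1*4*2*3)).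
(* In [tE] the terms in [t] are symmetric in [a] and [b]; the Lie identity makes the rest
   symmetric. *)
- rewrite -[LHS]/(t _) -[RHS]/(t _) !tE [in RHS]addrAC; congr (_ + _ + _).
  have := delta_lie a b; rewrite linearB => /eqP; rewrite subr_eq => /eqP ->.
  apply/eqP; rewrite !subr_eq opprB !addrA; apply/eqP.
  by rewrite [LHS](ACl (5*2*4*1*3)).
- by rewrite d'E subrK.
Qed.

End character_action.

(** * The two cases of the decomposition *)

Theorem theorem5p1 (R : realType) (U : banachAlgType R) (phi : Delta U)
    (U_amenable : johnson_amenable phi) (X : banachBimodType U)
    (X_phi : (forall (a : U) (x : X), ract x a = phi a *: x) \/
             (forall (a : U) (x : X), lact a x = phi a *: x))
    (delta : {linear U -> X}) (delta_cont : continuous delta)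
    (delta_lie : is_lie_derivation delta) :
  exists d t : {linear U -> X},
    [/\ continuous d, is_derivation d, continuous t, is_center_valued_trace t &
        forall a : U, delta a = d a + t a].
Proof.
have [e [e_phi e_left e_right]] := johnson_amenable_mean U_amenable.
have e_commutator a (g h : dual U) :
    (forall x, h x = g (amul a x - amul x a)) -> e h = 0.
  (* Here [ga] and [ga - h] are the left and right translates of [g] by [a], with equal means. *)
  move=> gh; pose ga : dual U := bop_comp g (mulop a).
  have -> : h = ga - (ga - h) by rewrite subKr.
  rewrite dualB (e_left a g ga)// (e_right a g (ga - h)) ?subrr// => x.
  by rewrite -[LHS]/(g (amul a x) - h x) gh -dualB subKr.
pose delta' : bop U X := mkbop (fun l a b => linearP delta l a b) delta_cont.
have phiM (a b : U) : char_dual phi (amul a b) = char_dual phi a * char_dual phi b.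
  exact: charM.
case: X_phi => X_phi.
  have [M M0 lM] := bound_rnorm (lact_bounded (s := X)).
  have [|d [t [dM tZ tC dt]]] := lie_derivation_character_action (delta := delta')
    (@lact_linearl _ _ X) (@lact_linearr _ _ X) M0 lM (@lactA _ _ X) phiM e_phi
    e_left e_commutator.
    move=> a b; rewrite -[LHS]/(delta (commutator a b)) delta_lie.
    by rewrite /bracket_xa /bracket_ax !X_phi addrC opprB.
  exists d, t; split=> [|a b||| //]; [exact: bop_cont| |exact: bop_cont|].
    by rewrite X_phi; exact: dM.
  split=> [a b|a b]; first by rewrite X_phi; exact: tZ.
  by rewrite linearB; apply/eqP; rewrite subr_eq0; apply/eqP; exact: tC.
have [M M0 rM] := bound_rnorm (ract_bounded (s := X)).
have rM' (a : U) (x : X) : rnorm (ract x a) <= M * rnorm a * rnorm x.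
  by rewrite mulrAC rM.
(* Under the opposite multiplication the right action becomes a left one, and right invariance of
   [e] replaces left invariance. *)
have [| | | |d [t [dM tZ tC dt]]] := lie_derivation_character_action
  (delta := delta') (mul := fun a b => amul b a) (act := fun a (x : X) => ract x a)
  (@ract_linearr _ _ X) (@ract_linearl _ _ X) M0 rM' _ _ e_phi e_right.
- by move=> a b x; rewrite ractA.
- by move=> a b; rewrite phiM mulrC.
(* Opposite commutators change sign, hence the passage to [- h]. *)
- move=> a g h gh; apply/eqP; rewrite -oppr_eq0 -mulN1r -dualZ scaleN1r.
  apply/eqP/(e_commutator a g) => x.
  by rewrite -[LHS]/(- h x) gh -linearN opprB.
- move=> a b; rewrite -[LHS]/(delta (amul b a - amul a b)) delta_lie.
  by rewrite /bracket_xa /bracket_ax !X_phi opprB.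
exists d, t; split=> [|a b||| //]; [exact: bop_cont| |exact: bop_cont|].
  by rewrite X_phi addrC; exact: dM.
split=> [a b|a b]; first by rewrite X_phi; exact/esym/tZ.
by rewrite linearB; apply/eqP; rewrite subr_eq0; apply/eqP; exact: tC.
Qed.
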